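(* Let $D$ be an integral domain and let $\Theta$ be a Jaffard family of $D$. Let $\mathbf{X}$ be a family of independent indeterminates over $D$. Then $$\mathrm{LPic}(D[\mathbf{X}],D)\simeq\bigoplus_{T\in\Theta}\mathrm{LPic}(T[\mathbf{X}],T).$$
   Context: $D$ is an integral domain that is not a field, with quotient field $K\neq D$. $\mathrm{Pic}(B)$ is the group of invertible fractional ideals of the domain $B$ modulo nonzero principal fractional ideals. For an extension $A\subseteq B$ of integral domains, the local Picard group is $\mathrm{LPic}(B,A):=\mathrm{Pic}(B)/\iota(\mathrm{Pic}(A))$, where $\iota:\mathrm{Pic}(A)\to\mathrm{Pic}(B)$, $[I]\mapsto[IB]$, is the canonical map. An overring of $D$ is a ring between $D$ and $K$; it is flat if it is flat as a $D$-module. A Jaffard family of $D$ is a family $\Theta$ of flat overrings of $D$ with $K\notin\Theta$ that is complete ($I=\bigcap_{T\in\Theta}IT$ for every ideal $I$ of $D$), independent ($TT'=K$ for all $T\neq T'$ in $\Theta$) and locally finite (every nonzero $x\in D$ is a non-unit in only finitely many $T\in\Theta$). *)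

(* Defs.v *)
From HB Require Import structures.
From mathcomp Require Import all_boot all_order all_algebra.
From mathcomp Require Import finmap boolp classical_sets cardinality.
From mathcomp Require Import monalg.

Set Implicit Arguments.
Unset Strict Implicit.
Unset Printing Implicit Defensive.

Import GRing.Theory.
Local Open Scope quotient_scope.
Local Open Scope classical_set_scope.
Local Open Scope ring_scope.

(* R[X_i | i in I], for an arbitrary (possibly infinite) index type I: finitely
   supported functions from the commutative monomials over I to R. *)
Definition polys (I : choiceType) (R : idomainType) := {malg R[{cmonom I}]}.

Section PolysDomain.
Variables (I : choiceType) (R : idomainType).

HB.instance Definition _ := GRing.ComNzRing.on (polys I R).

(* Kronecker's substitution, sending the i-th variable of V to 'X^(N ^ i). *)
Definition kron (N : nat) (V : seq I) (m : {cmonom I}) : nat :=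
  foldr (fun i acc => m i + N * acc)%N 0%N V.

Lemma kronM N V (m1 m2 : {cmonom I}) :
  kron N V (mmul m1 m2) = (kron N V m1 + kron N V m2)%N.
Proof.
elim: V => //= i V ->; rewrite cmM mulnDr.
by rewrite !addnA; congr (_ + _)%N; rewrite -!addnA; congr (_ + _)%N; rewrite addnC.
Qed.

Lemma kron1 N V : kron N V (@mone {cmonom I}) = 0%N.
Proof. by elim: V => //= i V ->; rewrite cm1 muln0. Qed.

Lemma kron_inj N V (m1 m2 : {cmonom I}) :
    (forall i, i \in V -> m1 i < N)%N -> (forall i, i \in V -> m2 i < N)%N ->
  kron N V m1 = kron N V m2 -> forall i, i \in V -> m1 i = m2 i.
Proof.
elim: V => //= j V IH lt1 lt2 eq12.
have l1 := lt1 j (mem_head _ _); have l2 := lt2 j (mem_head _ _).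
have e0 : m1 j = m2 j.
  have /(congr1 (modn^~ N)) := eq12.
  by rewrite -!(addnC (N * _)%N) !(mulnC N) !modnMDl !modn_small.
move=> i; rewrite inE => /orP[/eqP -> //|]; apply: IH.
- by move=> k kV; apply: lt1; rewrite inE kV orbT.
- by move=> k kV; apply: lt2; rewrite inE kV orbT.
- move/eqP: eq12; rewrite e0 eqn_add2l eqn_mul2l => /orP[/eqP N0|/eqP //].
  by rewrite N0 in l1.
Qed.

Definition kronX N V (m : {cmonom I}) : {poly R} := 'X^(kron N V m).

Lemma kronX_morph N V :
  {morph (kronX N V) : x y / mmul x y >-> x * y} * (kronX N V (@mone _) = 1).
Proof. by split=> [x y|]; rewrite /kronX ?kronM ?exprD ?kron1. Qed.

HB.instance Definition _ N V :=
  isMultiplicative.Build {cmonom I} {poly R} (kronX N V) (kronX_morph N V).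

Lemma kron_separates (s : seq {cmonom I}) :
  exists N V, {in s &, injective (kron N V)}.
Proof.
pose V := flatten [seq enum_fset (finsupp (cmonom_val m)) | m <- s].
pose N := (\max_(m <- s) \max_(i <- V) m i).+1.
have ltN m : m \in s -> forall i, i \in V -> (m i < N)%N.
  move=> ms i iV; rewrite /N ltnS.
  apply: (@leq_trans (\max_(j <- V) m j)%N).
    exact: (leq_bigmax_seq (F := fun j => m j)).
  exact: (leq_bigmax_seq (F := fun m0 : {cmonom I} => \max_(j <- V) m0 j)%N).
have out m i : m \in s -> i \notin V -> m i = 0%N.
  move=> ms; apply: contraNeq; rewrite cmE_neq0 => im.
  by apply/flattenP; exists (enum_fset (finsupp (cmonom_val m))); first exact: map_f.
exists N, V => m1 m2 s1 s2 e12; apply/eqP/cmP => i.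
have [iV|iV] := boolP (i \in V); last by rewrite !out.
exact: kron_inj (ltN _ s1) (ltN _ s2) e12 i iV.
Qed.

Lemma kron_neq0 N V (s : seq {cmonom I}) (p : {malg R[{cmonom I}]}) :
    {subset msupp p <= s} -> {in s &, injective (kron N V)} ->
  p != 0 -> mmap polyC (kronX N V) p != 0.
Proof.
move=> sub inj; rewrite -msupp_eq0 => /fset0Pn[m mp].
apply/eqP => /(congr1 (fun q : {poly R} => q`_(kron N V m))).
rewrite coef0 mmapE coef_sum (big_fsetD1 m) //= coefCM coefXn eqxx mulr1.
rewrite big1_fset => [|k]; first by rewrite addr0 => /eqP; rewrite mcoeff_eq0 mp.
rewrite in_fsetD1 => /andP[km kp] _; rewrite coefCM coefXn.
case: eqP => [/inj e|]; last by rewrite mulr0.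
by rewrite e ?eqxx ?sub in km.
Qed.

Lemma polys_integral (p q : polys I R) : p * q = 0 -> (p == 0) || (q == 0).
Proof.
move=> pq0; case: (eqVneq p 0) => //= p0; apply/negPn/negP => q0.
have [N [V inj]] := kron_separates (enum_fset (msupp p) ++ enum_fset (msupp q)).
have := congr1 (mmap polyC (kronX N V)) pq0.
rewrite rmorphM rmorph0 => /eqP; rewrite mulf_eq0.
have subp : {subset msupp p <= enum_fset (msupp p) ++ enum_fset (msupp q)}.
  by move=> x xp; rewrite mem_cat xp.
have subq : {subset msupp q <= enum_fset (msupp p) ++ enum_fset (msupp q)}.
  by move=> x xp; rewrite mem_cat xp orbT.
by rewrite (negPf (kron_neq0 subp inj p0)) (negPf (kron_neq0 subq inj q0)).
Qed.

Definition polys_unit : {pred polys I R} := fun p => `[< exists q, q * p = 1 >].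
Definition polys_inv (p : polys I R) : polys I R :=
  if pselect (exists q, q * p = 1) is left ex then projT1 (cid ex) else p.

Lemma polys_mulVx : {in polys_unit, left_inverse 1 polys_inv *%R}.
Proof.
move=> p /asboolP ex; rewrite /polys_inv.
by case: pselect => // ex'; case: (cid _).
Qed.

Lemma polys_unitPl (p q : polys I R) : q * p = 1 -> p \in polys_unit.
Proof. by move=> qp; apply/asboolP; exists q. Qed.

Lemma polys_inv_out : {in [predC polys_unit], polys_inv =1 id}.
Proof. by move=> p /asboolPn nex; rewrite /polys_inv; case: pselect. Qed.

HB.instance Definition _ := GRing.ComNzRing_hasMulInverse.Build (polys I R)
  polys_mulVx polys_unitPl polys_inv_out.
HB.instance Definition _ := GRing.ComUnitRing_isIntegral.Build (polys I R)
  polys_integral.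

End PolysDomain.

Section PicardGroups.
Variable L : fieldType.
Implicit Types (A B : subringClosed L) (I J : set L).

Definition ring_set A : set L := [set x | x \in A].

(* The finite sums of products x * y with x in I and y in J. *)
Definition mulset I J : set L :=
  [set z | exists2 s : seq (L * L),
    forall u, u \in s -> I u.1 /\ J u.2 & z = \sum_(u <- s) u.1 * u.2].

Lemma mulset_mem I J x y : I x -> J y -> mulset I J (x * y).
Proof.
by move=> Ix Jy; exists [:: (x, y)]; rewrite ?big_seq1 // => u; rewrite inE => /eqP ->.
Qed.

Lemma mulset0 I J : mulset I J 0.
Proof. by exists [::]; rewrite ?big_nil. Qed.

Lemma mulsetD I J x y : mulset I J x -> mulset I J y -> mulset I J (x + y).
Proof.
move=> [s hs ->] [t ht ->]; exists (s ++ t); last by rewrite big_cat.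
by move=> u; rewrite mem_cat => /orP[/hs|/ht].
Qed.

Lemma mulset_min I J H : H 0 -> (forall x y, H x -> H y -> H (x + y)) ->
  (forall x y, I x -> J y -> H (x * y)) -> mulset I J `<=` H.
Proof.
move=> H0 HD HM z [s hs ->]; rewrite big_seq; apply: big_ind => // u /hs[Iu Ju].
exact: HM.
Qed.

Lemma mulsetC I J : mulset I J = mulset J I.
Proof.
suff sub I' J' : mulset I' J' `<=` mulset J' I' by apply/seteqP; split; apply: sub.
apply: mulset_min => [|x y|x y Ix Jy]; [exact: mulset0|exact: mulsetD|].
by rewrite mulrC; apply: mulset_mem.
Qed.

Lemma mulsetA I J H : mulset I (mulset J H) = mulset (mulset I J) H.
Proof.
have sub I' J' H' : mulset I' (mulset J' H') `<=` mulset (mulset I' J') H'.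
  apply: mulset_min => [|x y|x y Ix]; [exact: mulset0|exact: mulsetD|].
  move: y; apply: (@mulset_min _ _ [set y | mulset (mulset I' J') H' (x * y)]) => /=.
  - by rewrite mulr0; apply: mulset0.
  - by move=> y z; rewrite mulrDr; apply: mulsetD.
  - by move=> y z Jy Hz; rewrite mulrA; do 2!apply: mulset_mem => //.
apply/seteqP; split; first exact: sub.
by rewrite mulsetC (mulsetC I) (mulsetC I) (mulsetC J H); apply: sub.
Qed.

Lemma mulsetACA I J H G :
  mulset (mulset I J) (mulset H G) = mulset (mulset I H) (mulset J G).
Proof. by rewrite -!mulsetA; congr mulset; rewrite !mulsetA (mulsetC J). Qed.

Definition submodule A I :=
  [/\ I 0, forall x y, I x -> I y -> I (x + y)
    & forall a x, a \in A -> I x -> I (a * x)].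

(* The quotient field of A is only implicit, as a subfield of L: the existence
   of d puts I inside it. *)
Definition fractional_ideal A I :=
  submodule A I /\
  exists d, [/\ d \in A, d != 0 & forall x, I x -> d * x \in A].

Definition invertible_ideal A I :=
  fractional_ideal A I /\
  exists2 J, fractional_ideal A J & mulset I J = ring_set A.

Lemma mulset_id A I : submodule A I -> mulset (ring_set A) I = I.
Proof.
move=> [I0 ID IM]; apply/seteqP; split; first by apply: mulset_min.
by move=> x Ix; rewrite -[x]mul1r; apply: mulset_mem => //; apply: rpred1.
Qed.

Lemma submodule_mul A I J : submodule A I -> submodule A (mulset I J).
Proof.
move=> [_ _ IM]; split=> [|x y|a x Aa]; [exact: mulset0|exact: mulsetD|].
move: x; apply: (@mulset_min _ _ [set x | mulset I J (a * x)]) => /=.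
- by rewrite mulr0; apply: mulset0.
- by move=> x y; rewrite mulrDr; apply: mulsetD.
- by move=> x y Ix Jy; rewrite mulrA; apply: mulset_mem => //; apply: IM.
Qed.

Lemma fractional_mul A I J :
  fractional_ideal A I -> fractional_ideal A J -> fractional_ideal A (mulset I J).
Proof.
move=> [sI [d [Ad d0 dI]]] [_ [e [Ae e0 eJ]]]; split; first exact: submodule_mul.
exists (d * e); split; [exact: rpredM|by rewrite mulf_neq0|].
apply: (@mulset_min _ _ [set x | d * e * x \in A]) => /=.
- by rewrite mulr0 rpred0.
- by move=> x y ? ?; rewrite mulrDr rpredD.
- by move=> x y Ix Jy; rewrite mulrACA rpredM ?dI ?eJ.
Qed.

Lemma fractional_unit A : fractional_ideal A (ring_set A).
Proof.
split; first by split=> [|x y|a x]; rewrite /ring_set /= ?rpred0 //; [exact: rpredD|exact: rpredM].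
by exists 1; split=> [||x Ax]; rewrite ?rpred1 ?oner_eq0 ?mul1r.
Qed.

Lemma invertible_unit A : invertible_ideal A (ring_set A).
Proof.
split; first exact: fractional_unit.
exists (ring_set A); first exact: fractional_unit.
by apply: mulset_id; case: (fractional_unit A).
Qed.

Lemma invertible_mul A I J :
  invertible_ideal A I -> invertible_ideal A J -> invertible_ideal A (mulset I J).
Proof.
move=> [fI [I' fI' II']] [fJ [J' fJ' JJ']]; split; first exact: fractional_mul.
exists (mulset I' J'); first exact: fractional_mul.
by rewrite mulsetACA II' JJ'; apply: mulset_id; case: (fractional_unit A).
Qed.

Lemma invertible_inv A I : invertible_ideal A I ->
  exists2 J, invertible_ideal A J & mulset J I = ring_set A.
Proof.
move=> [fI [J fJ IJ]]; exists J; last by rewrite mulsetC.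
by split=> //; exists I; rewrite // mulsetC.
Qed.

Lemma mulset_extend A B : {subset A <= B} ->
  mulset (ring_set A) (ring_set B) = ring_set B.
Proof.
move=> AB; apply/seteqP; split=> [|x Bx]; last first.
  by rewrite -[x]mul1r; apply: mulset_mem => //; apply: rpred1.
by apply: mulset_min => [|x y|x y /AB]; [exact: rpred0|exact: rpredD|exact: rpredM].
Qed.

Lemma fractional_extend A B I : {subset A <= B} ->
  fractional_ideal A I -> fractional_ideal B (mulset I (ring_set B)).
Proof.
move=> AB [[I0 ID IM] [d [Ad d0 dI]]]; split.
  by rewrite mulsetC; apply: submodule_mul; case: (fractional_unit B).
exists d; split; [exact: AB|by []|].
apply: (@mulset_min _ _ [set x | d * x \in B]) => /=.
- by rewrite mulr0 rpred0.
- by move=> x y ? ?; rewrite mulrDr rpredD.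
- by move=> x y Ix By; rewrite mulrA rpredM // AB ?dI.
Qed.

Lemma invertible_extend A B I : {subset A <= B} ->
  invertible_ideal A I -> invertible_ideal B (mulset I (ring_set B)).
Proof.
move=> AB [fI [J fJ IJ]]; split; first exact: fractional_extend fI.
exists (mulset J (ring_set B)); first exact: fractional_extend fJ.
rewrite mulsetACA IJ [mulset (ring_set B) _]mulset_id ?mulset_extend //.
by case: (fractional_unit B).
Qed.

(* The group of invertible fractional ideals of A. It is written additively:
   I + J is the product ideal and 0 is A. *)
Definition inv_ideals A := {I : set L | `[< invertible_ideal A I >]}.

Section InvIdealsGroup.
Variable A : subringClosed L.

HB.instance Definition _ := Choice.on (inv_ideals A).

Definition mk_inv I (hI : invertible_ideal A I) : inv_ideals A :=
  exist _ I (asboolT hI).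

Lemma inv_idealsP (I : inv_ideals A) : invertible_ideal A (sval I).
Proof. by case: I => I /= /asboolP. Qed.

Definition inv_zero : inv_ideals A := mk_inv (invertible_unit A).
Definition inv_add (I J : inv_ideals A) : inv_ideals A :=
  mk_inv (invertible_mul (inv_idealsP I) (inv_idealsP J)).
Definition inv_opp (I : inv_ideals A) : inv_ideals A :=
  mk_inv (s2valP (cid2 (invertible_inv (inv_idealsP I)))).

Lemma inv_addA : associative inv_add.
Proof. by move=> I J H; apply: val_inj; apply: mulsetA. Qed.

Lemma inv_addC : commutative inv_add.
Proof. by move=> I J; apply: val_inj; apply: mulsetC. Qed.

Lemma inv_add0 : left_id inv_zero inv_add.
Proof.
by move=> I; apply: val_inj; apply: mulset_id; case: (inv_idealsP I) => -[].
Qed.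

Lemma inv_addN : left_inverse inv_zero inv_opp inv_add.
Proof.
move=> I; apply: val_inj => /=.
exact: (s2valP' (cid2 (invertible_inv (inv_idealsP I)))).
Qed.

HB.instance Definition _ :=
  GRing.isZmodule.Build (inv_ideals A) inv_addA inv_addC inv_add0 inv_addN.

Definition principal : {pred inv_ideals A} := fun c =>
  `[< exists2 x, x != 0 & sval c = [set x * a | a in ring_set A] >].

Lemma principal_zmod_closed : zmod_closed principal.
Proof.
split.
  apply/asboolP; exists 1; first exact: oner_neq0.
  by apply/seteqP; split=> [x Ax|_ [x Ax <-]]; [exists x; rewrite ?mul1r|rewrite mul1r].
move=> I J /asboolP[x x0 eI] /asboolP[y y0 eJ]; apply/asboolP.
exists (x / y); first by rewrite mulf_neq0 ?invr_eq0.
have eI' : sval I = mulset (sval (I - J)) (sval J).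
  by rewrite -[LHS]/(sval I) -{1}(subrK J I).
have sIJ : submodule A (sval (I - J)) by case: (inv_idealsP (I - J)) => -[].
have [_ _ IJM] := sIJ.
have eIy z : sval I z <-> exists2 w, sval (I - J) w & z = y * w.
  split; last first.
    move=> [w Iw ->]; rewrite eI' eJ mulrC; apply: mulset_mem => //.
    by exists 1; [exact: rpred1|rewrite mulr1].
  suff sub : mulset (sval (I - J)) (sval J)
      `<=` [set z | exists2 w, sval (I - J) w & z = y * w].
    by rewrite eI'; apply: sub.
  rewrite eJ; apply: mulset_min => /=.
  - by exists 0; rewrite ?mulr0 //; case: sIJ.
  - move=> _ _ [u Iu ->] [v Iv ->]; exists (u + v); rewrite ?mulrDr //.
    by case: sIJ => _ + _; apply.
  - by move=> u _ Iu [a Aa <-]; exists (a * u); [exact: IJM|rewrite mulrC mulrA].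
apply/seteqP; split=> [w Iw|_ [a Aa <-]].
  have : sval I (y * w) by apply/eIy; exists w.
  by rewrite eI => -[a Aa e]; exists a => //; rewrite mulrAC e mulrAC mulfV ?mul1r.
have : sval I (x * a) by rewrite eI; exists a.
move=> /eIy[w Iw e]; suff -> : x / y * a = w by [].
by rewrite mulrAC e mulrAC mulfV ?mul1r.
Qed.

HB.instance Definition _ :=
  GRing.isZmodClosed.Build (inv_ideals A) principal principal_zmod_closed.

Definition Pic := Quotient.quot principal.

HB.instance Definition _ := GRing.Zmodule.on Pic.

End InvIdealsGroup.

Arguments principal A : clear implicits.

Section PicMap.
Variables (A B : subringClosed L) (AB : {subset A <= B}).

Definition extend_ideal (I : inv_ideals A) : inv_ideals B :=
  mk_inv (invertible_extend AB (inv_idealsP I)).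

Lemma extend_ideal_is_zmod_morphism : zmod_morphism extend_ideal.
Proof.
have extendD : {morph extend_ideal : I J / I + J}.
  move=> I J.
  apply: val_inj; rewrite /= mulsetACA; congr mulset.
  by rewrite mulset_id //; case: (fractional_unit B).
by move=> I J; apply: (addIr (extend_ideal J)); rewrite -extendD !subrK.
Qed.

HB.instance Definition _ := GRing.isZmodMorphism.Build
  (inv_ideals A) (inv_ideals B) extend_ideal extend_ideal_is_zmod_morphism.

Lemma extend_ideal_principal (I : inv_ideals A) : I \in principal A -> extend_ideal I \in principal B.
Proof.
move=> /asboolP[x x0 eI]; apply/asboolP; exists x => //=; rewrite eI.
apply/seteqP; split=> [|_ [b Bb <-]]; last first.
  by apply: mulset_mem => //; exists 1; [exact: rpred1|rewrite mulr1].
apply: mulset_min.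
- by exists 0; [exact: rpred0|rewrite mulr0].
- by move=> _ _ [a Ba <-] [b Bb <-]; exists (a + b); [exact: rpredD|rewrite mulrDr].
- by move=> _ b [a Aa <-] Bb; exists (a * b); [apply: rpredM => //; exact: AB|rewrite mulrA].
Qed.

(* The canonical map iota : [I] |-> [IB]. *)
Definition Pic_map (c : Pic A) : Pic B := \pi_(Pic B) (extend_ideal (repr c)).

Lemma Pic_mapE (I : inv_ideals A) : Pic_map (\pi_(Pic A) I) = \pi_(Pic B) (extend_ideal I).
Proof.
apply/eqP; rewrite -Quotient.idealrBE -raddfB; apply: extend_ideal_principal.
by rewrite Quotient.idealrBE reprK.
Qed.

Lemma Pic_map_is_zmod_morphism : zmod_morphism Pic_map.
Proof.
by move=> c d; rewrite -[c]reprK -[d]reprK -raddfB !Pic_mapE !raddfB.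
Qed.

HB.instance Definition _ :=
  GRing.isZmodMorphism.Build (Pic A) (Pic B) Pic_map Pic_map_is_zmod_morphism.

Definition Pic_image : {pred Pic B} := fun c => `[< exists d, c = Pic_map d >].

Lemma Pic_image_zmod_closed : zmod_closed Pic_image.
Proof.
split; first by apply/asboolP; exists 0; rewrite raddf0.
move=> _ _ /asboolP[c ->] /asboolP[d ->].
by apply/asboolP; exists (c - d); rewrite raddfB.
Qed.

HB.instance Definition _ :=
  GRing.isZmodClosed.Build (Pic B) Pic_image Pic_image_zmod_closed.

Definition LPic := Quotient.quot Pic_image.

HB.instance Definition _ := GRing.Zmodule.on LPic.

End PicMap.
End PicardGroups.

Arguments principal {L} A.

Section DirectSum.
Variables (J : Type) (G : J -> zmodType).

Definition dprod := forall j, G j.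

HB.instance Definition _ := Choice.on dprod.

Lemma dprod_addA : associative (fun (f g : dprod) j => f j + g j).
Proof. by move=> f g h; apply/functional_extensionality_dep => j; apply: addrA. Qed.

Lemma dprod_addC : commutative (fun (f g : dprod) j => f j + g j).
Proof. by move=> f g; apply/functional_extensionality_dep => j; apply: addrC. Qed.

Lemma dprod_add0 : left_id (fun j => 0) (fun (f g : dprod) j => f j + g j).
Proof. by move=> f; apply/functional_extensionality_dep => j; apply: add0r. Qed.

Lemma dprod_addN :
  left_inverse (fun j => 0) (fun (f : dprod) j => - f j) (fun (f g : dprod) j => f j + g j).
Proof. by move=> f; apply/functional_extensionality_dep => j; apply: addNr. Qed.

HB.instance Definition _ :=
  GRing.isZmodule.Build dprod dprod_addA dprod_addC dprod_add0 dprod_addN.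

Definition finite_support : {pred dprod} := fun f =>
  `[< finite_set [set j | f j != 0] >].

Lemma finite_support_zmod_closed : zmod_closed finite_support.
Proof.
split.
  apply/asboolP; suff -> : [set j | (0 : dprod) j != 0] = set0 by exact: finite_set0.
  by apply/seteqP; split=> j //=; rewrite eqxx.
move=> f g /asboolP ff /asboolP fg; apply/asboolP.
have /sub_finite_set : [set j | (f - g) j != 0] `<=`
    [set j | f j != 0] `|` [set j | g j != 0].
  move=> j /=; have -> : (f - g) j = f j - g j by [].
  case: (eqVneq (f j) 0) => [-> |]; last by left.
  by rewrite sub0r oppr_eq0; right.
by apply; rewrite finite_setU.
Qed.

HB.instance Definition _ :=
  GRing.isZmodClosed.Build dprod finite_support finite_support_zmod_closed.

Definition dsum := {f : dprod | f \in finite_support}.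

HB.instance Definition _ := SubChoice.on dsum.
HB.instance Definition _ := [SubChoice_isSubZmodule of dsum by <:].

End DirectSum.

Section Flatness.
Variable R : comNzRingType.

Section Tensor.
Variables M N : lmodType R.

(* The subgroup of the free abelian group on M * N generated by the relations
   defining the tensor product. *)
Inductive tensor_rel : {malg int[(M * N)%type]} -> Prop :=
| tensor_rel0 : tensor_rel 0
| tensor_relB z t : tensor_rel z -> tensor_rel t -> tensor_rel (z - t)
| tensor_relDl m m' n :
    tensor_rel (<< (m + m', n) >> - << (m, n) >> - << (m', n) >>)
| tensor_relDr m n n' :
    tensor_rel (<< (m, n + n') >> - << (m, n) >> - << (m, n') >>)
| tensor_relZ a m n : tensor_rel (<< (a *: m, n) >> - << (m, a *: n) >>).

Definition tensor_null : {pred {malg int[(M * N)%type]}} :=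
  fun z => `[< tensor_rel z >].

Lemma tensor_null_zmod_closed : zmod_closed tensor_null.
Proof.
split; first by apply/asboolP; constructor.
by move=> z t /asboolP hz /asboolP ht; apply/asboolP; constructor.
Qed.

HB.instance Definition _ :=
  GRing.isZmodClosed.Build _ tensor_null tensor_null_zmod_closed.

Definition tensor := Quotient.quot tensor_null.

End Tensor.

(* id_M (x) f; the choice of representative is immaterial when f is linear. *)
Definition tensor_map (M N N' : lmodType R) (f : N -> N') (c : tensor M N) :
    tensor M N' :=
  \pi_(tensor M N')
    (\sum_(u <- msupp (repr c)) << (repr c)@_u *g (u.1, f u.2) >>).

Definition flat (M : lmodType R) :=
  forall (N N' : lmodType R) (f : {linear N -> N'}),
    injective f -> injective (tensor_map (M := M) f).

End Flatness.

Section Overrings.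
Variable D : idomainType.
Local Notation K := {fraction D}.

Record overring := Overring {
  overring_ring :> subringClosed K;
  overring_tofrac : forall a : D, tofrac a \in overring_ring
}.

Lemma overring_ext (T T' : overring) : (forall x, (x \in T) = (x \in T')) -> T = T'.
Proof.
case: T T' => [[T [[c1] [c2] [c3] [c4]]] h] [[T' [[d1] [d2] [d3] [d4]]] h'] /= e.
have eT : T = T' by apply: funext => x; apply: e.
subst T'; rewrite (Prop_irrelevance c1 d1) (Prop_irrelevance c2 d2).
move: h h'; rewrite (Prop_irrelevance c3 d3) (Prop_irrelevance c4 d4) => h h'.
by rewrite (Prop_irrelevance h h').
Qed.

Definition base_pred : {pred K} := fun x => `[< exists a, x = tofrac a >].

Lemma base_subring_closed : subring_closed base_pred.
Proof.
split; first by apply/asboolP; exists 1; rewrite tofrac1.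
- move=> _ _ /asboolP[a ->] /asboolP[b ->].
  by apply/asboolP; exists (a - b); rewrite tofracB.
- move=> _ _ /asboolP[a ->] /asboolP[b ->].
  by apply/asboolP; exists (a * b); rewrite tofracM.
Qed.

HB.instance Definition _ :=
  GRing.isSubringClosed.Build K base_pred base_subring_closed.

Lemma base_tofrac a : tofrac a \in base_pred.
Proof. by apply/asboolP; exists a. Qed.

Definition base_ring : overring := @Overring base_pred base_tofrac.

Section OverringModule.
Variable T : overring.

Definition overring_mod := {x : K | x \in T}.

HB.instance Definition _ := SubChoice.on overring_mod.
HB.instance Definition _ := [SubChoice_isSubZmodule of overring_mod by <:].

Definition overring_scale (a : D) (x : overring_mod) : overring_mod :=
  exist _ (tofrac a * val x) (rpredM (overring_tofrac T a) (valP x)).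

Lemma overring_scaleA a b x :
  overring_scale a (overring_scale b x) = overring_scale (a * b) x.
Proof. by apply: val_inj; rewrite /= tofracM mulrA. Qed.

Lemma overring_scale1 : left_id 1 overring_scale.
Proof. by move=> x; apply: val_inj; rewrite /= tofrac1 mul1r. Qed.

Lemma overring_scaleDr : right_distributive overring_scale +%R.
Proof. by move=> a x y; apply: val_inj; rewrite /= mulrDr. Qed.

Lemma overring_scaleDl x : {morph overring_scale^~ x : a b / a + b}.
Proof. by move=> a b; apply: val_inj; rewrite /= tofracD mulrDl. Qed.

HB.instance Definition _ := GRing.Zmodule_isLmodule.Build D overring_mod
  overring_scaleA overring_scale1 overring_scaleDr overring_scaleDl.

End OverringModule.

Record Jaffard_family (Theta : set overring) : Prop := {
  Jaffard_flat : forall T, Theta T -> flat (overring_mod T);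
  Jaffard_proper : forall T, Theta T -> ring_set T != setT;
  Jaffard_complete : forall I : set K,
    submodule base_ring I -> I `<=` ring_set base_ring ->
    I = \bigcap_(T in Theta) mulset I (ring_set T);
  Jaffard_independent : forall T T', Theta T -> Theta T' -> T <> T' ->
    mulset (ring_set T) (ring_set T') = setT;
  (* x lies in every overring, so it is a non-unit of T iff x^-1 \notin T *)
  Jaffard_locally_finite : forall x : D, x != 0 ->
    finite_set [set T | Theta T /\ (tofrac x)^-1 \notin T]
}.

End Overrings.

Arguments base_ring D : clear implicits.

Section PolynomialExtension.
Variables (D : idomainType) (X : choiceType).
Local Notation K := {fraction D}.

(* K(X). T and T[X], for an overring T of D, are taken as subrings of it: below,
   const_ring is the image of T (the constant polynomials), polys_ring is T[X]. *)
Definition ratfuns := {fraction polys X K}.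
HB.instance Definition _ := GRing.Field.on ratfuns.

Variable T : overring D.

Definition const_pred : {pred ratfuns} := fun z =>
  `[< exists2 c : K, c \in T & z = tofrac (c%:MP : polys X K) >].

Definition polys_pred : {pred ratfuns} := fun z =>
  `[< exists2 p : polys X K, p \is a monalgOver T & z = tofrac p >].

Lemma const_subring_closed : subring_closed const_pred.
Proof.
split; first by apply/asboolP; exists 1; rewrite ?rpred1 ?tofrac1.
- move=> _ _ /asboolP[a Ta ->] /asboolP[b Tb ->]; apply/asboolP.
  by exists (a - b); rewrite ?rpredB // raddfB /= tofracB.
- move=> _ _ /asboolP[a Ta ->] /asboolP[b Tb ->]; apply/asboolP.
  by exists (a * b); rewrite ?rpredM // (rmorphM malgC) tofracM.
Qed.

Lemma polys_subring_closed : subring_closed polys_pred.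
Proof.
split; first by apply/asboolP; exists 1; rewrite ?monalgOver1 ?tofrac1.
- move=> _ _ /asboolP[p Tp ->] /asboolP[q Tq ->]; apply/asboolP.
  exists (p - q); last by rewrite tofracB.
  by apply/(monalgOverP T) => m; rewrite mcoeffB rpredB //; apply/(monalgOverP T).
- move=> _ _ /asboolP[p Tp ->] /asboolP[q Tq ->]; apply/asboolP.
  exists (p * q); last by rewrite tofracM.
  by case: (monalgOver_mulr_closed {cmonom X} T) => _; apply.
Qed.

HB.instance Definition _ :=
  GRing.isSubringClosed.Build ratfuns const_pred const_subring_closed.
HB.instance Definition _ :=
  GRing.isSubringClosed.Build ratfuns polys_pred polys_subring_closed.

Definition const_ring : subringClosed ratfuns := const_pred.
Definition polys_ring : subringClosed ratfuns := polys_pred.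

Lemma const_sub_polys : {subset const_ring <= polys_ring}.
Proof.
move=> _ /asboolP[c Tc ->]; apply/asboolP; exists c%:MP => //.
by rewrite monalgOverC.
Qed.

Definition LPic_polys := LPic const_sub_polys.
HB.instance Definition _ := GRing.Zmodule.on LPic_polys.

End PolynomialExtension.

(* Main.v *)
Require Import Defs.
From HB Require Import structures.
From mathcomp Require Import all_boot all_algebra boolp classical_sets.
From mathcomp Require Import finmap cardinality monalg.

(* An invertible ideal of D[X] becomes principal in K[X], which is a GCD domain;
   so, up to a scalar, it may be taken with I K[X] = K[X], and then I and its
   inverse both contain nonzero elements of D. By local finiteness, I T[X] = T[X]
   for almost all T, so that I |-> (class of I T[X])_T lands in the direct sum.
   Flatness enters only as (D : t)T = T for t in T, which gives
   (I T[X]) /\ K = (I /\ K)T.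
   Kernel: if every I T[X] is extended from T, then J = I /\ K satisfies
   J T[X] = I T[X] for all T; completeness makes J invertible, with I = J D[X].
   Image: an ideal I0 of T0[X] is the T0-component of
   I = I0 /\ \bigcap_(T != T0) T[X]; independence gives (d T0 /\ D)T = T for
   T != T0 and d != 0, hence I T[X] = T[X] there. *)

Set Implicit Arguments.
Unset Strict Implicit.
Unset Printing Implicit Defensive.

Import GRing.Theory.
Local Open Scope quotient_scope.
Local Open Scope classical_set_scope.
Local Open Scope ring_scope.

(** * Products of ideals and local Picard classes *)

(** A flat overring T need not be a localization of D at a multiplicative set, so an element of an
    extended ideal has in general no single denominator. A subset E of D with E T = T does the same
    work: if E a lies in N, then a lies in N T, and products of such sets are again such sets.
    Flatness and independence are both turned into the existence of sets E of this kind. The ideals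
    obtained by intersection come with only one evident inclusion into the ideal that they should
    generate. The same inclusion holds for the inverses, and both products are the unit ideal, so it
    is an equality. X may be infinite. Principality of an invertible ideal of K[X] is therefore
    reduced to finitely many equations between finitely many polynomials, and the GCD property is
    used only in finitely many variables. *)

Lemma additive_lift_bij (G Q H : zmodType) (q : {additive G -> Q})
    (f : {additive G -> H}) :
    (forall y, exists x, q x = y) -> (forall y, exists x, f x = y) ->
    (forall x, q x = 0 <-> f x = 0) ->
  exists phi : {additive Q -> H}, bijective phi.
Proof.
move=> qS fS qf.
have qfE x y : q x = q y <-> f x = f y.
  by split=> /eqP; rewrite -subr_eq0 -raddfB => /eqP/qf/eqP;
    rewrite raddfB subr_eq0 => /eqP.
(* s and t are mere set-theoretic sections. [f \o s] is additive and inverse to [q \o t] because q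
   and f identify the same pairs. *)
pose s y := projT1 (cid (qS y)); pose t y := projT1 (cid (fS y)).
have sK y : q (s y) = y by rewrite /s; case: cid.
have tK y : f (t y) = y by rewrite /t; case: cid.
have phiB : zmod_morphism (f \o s).
  by move=> x y /=; rewrite -raddfB; apply/qfE; rewrite raddfB !sK.
pose phi : {additive Q -> H} :=
  HB.pack (f \o s) (GRing.isZmodMorphism.Build Q H (f \o s) phiB).
exists phi; exists (q \o t) => y /=.
  by rewrite -[RHS]sK; apply/qfE; rewrite tK.
by rewrite -[RHS]tK; apply/qfE; rewrite sK.
Qed.

Section SetProducts.
Variable L : fieldType.
Implicit Types (A B : subringClosed L) (I J : set L) (u v : L).

Lemma mulset_mono I I' J J' : I `<=` I' -> J `<=` J' -> mulset I J `<=` mulset I' J'.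
Proof.
move=> II' JJ'; apply: mulset_min; [exact: mulset0|exact: mulsetD|].
by move=> x y /II' Ix /JJ' Jy; apply: mulset_mem.
Qed.

Lemma submodule_ring A : submodule A (ring_set A).
Proof. by case: (fractional_unit A). Qed.

Lemma submodule_sub A B I : {subset A <= B} -> submodule B I -> submodule A I.
Proof. by move=> AB [I0 ID IM]; split=> // a x /AB; apply: IM. Qed.

Lemma submodule_mulr A I J : submodule A J -> submodule A (mulset I J).
Proof. by rewrite mulsetC; apply: submodule_mul. Qed.

Lemma mulset_idr A I : submodule A I -> mulset I (ring_set A) = I.
Proof. by rewrite mulsetC; apply: mulset_id. Qed.

Lemma mulset_ring A : mulset (ring_set A) (ring_set A) = ring_set A.
Proof. exact: mulset_id (submodule_ring A). Qed.

Lemma mulset1E A I u : submodule A I -> mulset [set u] I = [set u * x | x in I].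
Proof.
move=> [I0 ID _]; apply/seteqP; split; last first.
  by move=> _ [x Ix <-]; apply: mulset_mem.
apply: mulset_min; first by exists 0; rewrite ?mulr0.
- by move=> _ _ [x Ix <-] [y Iy <-]; exists (x + y); [exact: ID|rewrite mulrDr].
- by move=> _ y -> Iy; exists y.
Qed.

Lemma mulset11 A I u v : submodule A I ->
  mulset [set u] (mulset [set v] I) = mulset [set u * v] I.
Proof.
move=> sI; rewrite (mulset1E v sI) (mulset1E _ sI) (@mulset1E A).
  apply/seteqP; split=> [_ [_ [x Ix <-] <-]|_ [x Ix <-]].
    by exists x; rewrite ?mulrA.
  by exists (v * x); rewrite ?mulrA //; exists x.
by rewrite -(mulset1E v sI); apply: submodule_mulr.
Qed.

Lemma mulset1K A I u : u != 0 -> submodule A I ->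
  mulset [set u^-1] (mulset [set u] I) = I.
Proof.
move=> u0 sI; rewrite (mulset11 _ _ sI) mulVf // (mulset1E _ sI).
by apply/seteqP; split=> [_ [x Ix <-]|x Ix]; [rewrite mul1r|exists x; rewrite ?mul1r].
Qed.

Lemma submodule_inv A (I : inv_ideals A) : submodule A (sval I).
Proof. by case: (inv_idealsP I) => -[]. Qed.

Lemma inv_idealsD A (I J : inv_ideals A) : sval (I + J) = mulset (sval I) (sval J).
Proof. by []. Qed.

Lemma mulset_invN A (I : inv_ideals A) : mulset (sval I) (sval (- I)) = ring_set A.
Proof. by rewrite -inv_idealsD subrr. Qed.

Lemma fractional_principal A d u : d \in A -> d != 0 -> d * u \in A ->
  fractional_ideal A (mulset [set u] (ring_set A)).
Proof.
move=> Ad d0 Adu; have sA := submodule_ring A.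
split; first exact: submodule_mulr.
exists d; split=> // x; rewrite (mulset1E u sA) => -[a Aa <-].
by rewrite mulrA rpredM.
Qed.

Lemma invertible_principal A d u : d \in A -> d != 0 -> d * u \in A -> u != 0 ->
  invertible_ideal A (mulset [set u] (ring_set A)).
Proof.
move=> Ad d0 Adu u0; split; first exact: fractional_principal Adu.
exists (mulset [set u^-1] (ring_set A)).
  apply: (@fractional_principal A (d * u)); rewrite ?mulf_neq0 //.
  by rewrite mulfK.
rewrite mulsetACA mulset_ring -mulsetA -{1}[u]invrK (@mulset1K A) ?invr_eq0 //.
exact: submodule_ring.
Qed.

(** Since [I J = A], one has [I' = I (J I')], and [J I'] lies in [J' I' = A]; hence I' lies in I. *)
Lemma inv_ideals_sub_eq A I I' J J' :
    submodule A I' -> I `<=` I' -> J `<=` J' ->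
    mulset I J = ring_set A -> mulset I' J' = ring_set A -> submodule A I ->
  I = I'.
Proof.
move=> sI' II' JJ' IJ I'J' sI; apply/seteqP; split=> //.
rewrite -(mulset_id sI') -IJ -mulsetA -{2}(mulset_idr sI).
by apply: mulset_mono => //; rewrite -I'J' mulsetC; apply: mulset_mono.
Qed.

End SetProducts.

Section Class.
Variables (L : fieldType) (A B : subringClosed L) (AB : {subset A <= B}).

Definition LPic_class (I : inv_ideals B) : LPic AB :=
  \pi_(LPic AB) (\pi_(Pic B) I).

Lemma LPic_class_is_zmod_morphism : zmod_morphism LPic_class.
Proof. by move=> I J; rewrite /LPic_class !raddfB. Qed.

HB.instance Definition _ := GRing.isZmodMorphism.Build
  (inv_ideals B) (LPic AB) LPic_class LPic_class_is_zmod_morphism.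

Lemma LPic_class_surj (c : LPic AB) : exists I, LPic_class I = c.
Proof. by exists (repr (repr c)); rewrite /LPic_class !reprK. Qed.

(** The quotients by principal ideals and by the image of [Pic A] are unfolded together, so that
    vanishing of a class becomes an equation between subsets of L. *)
Lemma LPic_class_eq0 (I : inv_ideals B) :
  LPic_class I = 0 <->
  exists2 u, u != 0 & exists J : inv_ideals A,
    sval I = mulset [set u] (mulset (sval J) (ring_set B)).
Proof.
have -> : LPic_class I = 0 <-> exists J : inv_ideals A, I - extend_ideal AB J \in principal B.
  rewrite /LPic_class -[0](raddf0 (\pi_(LPic AB))).
  split=> [/eqP|[J]].
    rewrite -Quotient.idealrBE subr0 => /asboolP[d]; rewrite -[d]reprK Pic_mapE.
    by move=> /eqP; rewrite -Quotient.idealrBE; exists (repr d).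
  rewrite Quotient.idealrBE => /eqP eIJ; apply/eqP; rewrite -Quotient.idealrBE subr0.
  by apply/asboolP; exists (\pi_(Pic A) J); rewrite Pic_mapE eIJ.
have sB := submodule_ring B.
split=> [[J /asboolP[u u0 eIJ]]|[u u0 [J eIJ]]]; last first.
  exists J; apply/asboolP; exists u => //; rewrite -(mulset1E u sB).
  by rewrite -(mulset_invN (extend_ideal AB J)) mulsetA -eIJ.
exists u => //; exists J.
rewrite -[X in sval X = _](subrK (extend_ideal AB J)).
rewrite inv_idealsD eIJ -(mulset1E u sB).
by rewrite -mulsetA mulset_id //; apply: submodule_mulr.
Qed.
End Class.

(** * Jaffard decomposition in an abstract setting *)

Lemma LPic_class_scale (L : fieldType) (A B : subringClosed L)
    (AB : {subset A <= B}) (I I' : inv_ideals B) (u : L) :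
  u != 0 -> sval I = mulset [set u] (sval I') -> LPic_class AB I = LPic_class AB I'.
Proof.
move=> u0 eI; apply/eqP; rewrite -subr_eq0 -raddfB; apply/eqP/LPic_class_eq0.
exists u => //; exists 0; rewrite [sval (0 : inv_ideals A)]/(ring_set A) mulset_extend //.
rewrite inv_idealsD eI.
by rewrite -mulsetA mulset_invN.
Qed.

Section Jaffard.
(* A, Kc, AX, KX, T j and TX j stand for D, K, D[X], K[X], T and T[X], all
   inside L = K(X). Below, mulset E (ring_set (T j)) 1 says that E T = T. *)
Variables (L : fieldType) (A Kc AX KX : subringClosed L).
Variables (J : choiceType) (T TX : J -> subringClosed L).
Hypothesis AT : forall j, {subset A <= T j}.
Hypothesis TK : forall j, {subset T j <= Kc}.
Hypothesis AK : {subset A <= Kc}.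
Hypothesis AAX : {subset A <= AX}.
Hypothesis TTX : forall j, {subset T j <= TX j}.
Hypothesis TXE : forall j, ring_set (TX j) = mulset (ring_set AX) (ring_set (T j)).
Hypothesis KXE : ring_set KX = mulset (ring_set AX) (ring_set Kc).
Hypothesis AXK : forall x, x \in AX -> x \in Kc -> x \in A.
Hypothesis KcV : forall x, x \in Kc -> x^-1 \in Kc.
Hypothesis Kc_frac :
  forall x, x \in Kc -> exists d, [/\ d \in A, d != 0 & d * x \in A].
Hypothesis L_frac : forall x, exists d, [/\ d \in AX, d != 0 & d * x \in AX].
Hypothesis KX_unit : forall u, u \in KX -> u^-1 \in KX -> u \in Kc.
Hypothesis KX_Pic : forall I, invertible_ideal KX I ->
  exists2 u : L, u != 0 & I = mulset [set u] (ring_set KX).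
Hypothesis T_loc : forall j t, t \in T j ->
  mulset [set a | a \in A /\ a * t \in A] (ring_set (T j)) 1.
Hypothesis T_indep : forall i j x,
  i != j -> x \in Kc -> mulset (ring_set (T i)) (ring_set (T j)) x.
Hypothesis T_finite : forall d, d \in A -> d != 0 ->
  finite_set [set j | d^-1 \notin T j].
Hypothesis T_complete : forall I, submodule A I -> I `<=` ring_set A ->
  (forall j, mulset I (ring_set (T j)) 1) -> I 1.
Hypothesis TX_complete : forall x, x \in KX -> (forall j, x \in TX j) -> x \in AX.

Let AXTX j : {subset AX <= TX j}.
Proof.
move=> x AXx; suff : ring_set (TX j) x by []; rewrite TXE -[x]mulr1.
by apply: mulset_mem => //; apply: rpred1.
Qed.

Let AXKX : {subset AX <= KX}.
Proof.
move=> x AXx; suff : ring_set KX x by []; rewrite KXE -[x]mulr1.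
by apply: mulset_mem => //; apply: rpred1.
Qed.

(** Write 1 as a sum of products [e * t] and multiply by a. *)
Lemma comax_mem j E N a : mulset E (ring_set (T j)) 1 ->
  (forall e, E e -> N (e * a)) -> mulset N (ring_set (T j)) a.
Proof.
move=> E1 EN; rewrite -[a]mul1r; move: 1 E1.
apply: (@mulset_min _ _ _ [set z | mulset N (ring_set (T j)) (z * a)]) => /=.
- by rewrite mul0r; apply: mulset0.
- by move=> x y; rewrite mulrDl; apply: mulsetD.
- by move=> e t Ee Tt; rewrite mulrAC; apply: mulset_mem => //; apply: EN.
Qed.

Lemma comax_mul j E E' : mulset E (ring_set (T j)) 1 ->
  mulset E' (ring_set (T j)) 1 -> mulset (mulset E E') (ring_set (T j)) 1.
Proof.
move=> E1 E'1; rewrite -(mulset_ring (T j)) mulsetACA -[1]mulr1.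
exact: mulset_mem.
Qed.

Lemma comax_sub j E E' : E `<=` E' -> mulset E (ring_set (T j)) 1 ->
  mulset E' (ring_set (T j)) 1.
Proof. by move=> EE'; apply: mulset_mono. Qed.

(** If E works for a and E' for b, then the product of E and E' works for [a + b]; for [x * t] the
    denominators of t from [T_loc] do. Together with [comax_mem], this lets intersections pass
    through the extension to T. *)
Lemma comax_denominators j M a : submodule A M -> mulset M (ring_set (T j)) a ->
  mulset [set e | e \in A /\ M (e * a)] (ring_set (T j)) 1.
Proof.
move=> [M0 MD MM]; move: a.
apply: (@mulset_min _ _ _ [set a | mulset [set e | e \in A /\ M (e * a)] (ring_set (T j)) 1]) => /=.
- rewrite -[X in mulset _ _ X]mulr1; apply: mulset_mem; last exact: rpred1.
  by split; rewrite ?rpred1 // mulr0.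
- move=> a b Ea Eb; apply: comax_sub (comax_mul Ea Eb).
  apply: mulset_min => /=; first by rewrite mul0r; split; rewrite ?rpred0.
  + by move=> x y [Ax Mx] [Ay My]; rewrite mulrDl; split; [apply: rpredD|apply: MD].
  + move=> x y [Ax Mx] [Ay My]; split; first exact: rpredM.
    by rewrite mulrDr; apply: MD; [rewrite mulrAC mulrC; apply: MM|rewrite -mulrA; apply: MM].
- move=> x t Mx Tt; apply: comax_sub (T_loc Tt) => e /= [Ae Aet]; split=> //.
  by rewrite mulrCA mulrC; apply: MM.
Qed.

Lemma submodule_capK M : submodule A M -> submodule A [set x | M x /\ x \in Kc].
Proof.
move=> [M0 MD MM]; split=> /= [|x y [Mx Kx] [My Ky]|a x Aa [Mx Kx]].
- by rewrite rpred0.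
- by split; [exact: MD|exact: rpredD].
- by split; [exact: MM|rewrite rpredM // AK].
Qed.

(** These e are the denominators of [d^-1] with respect to [T i], and by independence [d^-1] lies in
    the product of [T i] and [T j]. *)
Lemma comax_indep i j d : i != j -> d \in A ->
  mulset [set e | e \in A /\ e / d \in T i] (ring_set (T j)) 1.
Proof.
move=> ij Ad; apply: (@comax_denominators j (ring_set (T i))).
  exact: submodule_sub (AT i) (submodule_ring (T i)).
by apply: T_indep => //; apply: KcV; apply: AK.
Qed.

(** Outside a finite list s, [d^-1] is in [T i] and every e in A works; over s, the finitely many
    sets of [comax_indep] are multiplied. *)
Lemma comax_indep_all j d : d \in A -> d != 0 ->
  mulset [set e | e \in A /\ forall i, i != j -> e / d \in T i] (ring_set (T j)) 1.
Proof.
move=> Ad d0; have /finite_seqP[s es] := T_finite Ad d0.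
have : mulset [set e | e \in A /\ forall i, i \in s -> i != j -> e / d \in T i]
    (ring_set (T j)) 1.
  elim: s {es} => [|i s IH].
    rewrite -[X in mulset _ _ X]mulr1; apply: mulset_mem; last exact: rpred1.
    by split; rewrite ?rpred1.
  have [->|ij] := eqVneq i j.
    apply: comax_sub IH => e [Ae Te]; split=> // k; rewrite inE => /orP[/eqP->|/Te //].
    by rewrite eqxx.
  apply: comax_sub (comax_mul IH (comax_indep ij Ad)).
  apply: mulset_min => /=.
  - by rewrite rpred0; split=> // k; rewrite mul0r rpred0.
  - move=> x y [Ax Tx] [Ay Ty]; rewrite rpredD //; split=> // k ks kj.
    by rewrite mulrDl rpredD ?Tx ?Ty.
  - move=> x y [Ax Tx] [Ay Ty]; rewrite rpredM //; split=> // k.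
    rewrite inE => /orP[/eqP -> _|ks kj].
      by rewrite -mulrA rpredM // AT.
    by rewrite mulrAC rpredM ?Tx ?AT.
apply: comax_sub => e [Ae Te]; split=> // i ij.
have [/Te->//|si] := boolP (i \in s); apply: rpredM; first exact: AT.
by apply: contraT => ndi; have : [set i | d^-1 \notin T i] i by []; rewrite es /= (negPf si).
Qed.

(** * Denominators and normalization over K[X] *)

Lemma mulset_denominator I z : submodule A I -> mulset I (ring_set Kc) z ->
  exists d, [/\ d \in A, d != 0 & I (d * z)].
Proof.
move=> [I0 ID IM]; move: z.
apply: (@mulset_min _ _ _ [set z | exists d, [/\ d \in A, d != 0 & I (d * z)]]) => /=.
- by exists 1; rewrite rpred1 oner_neq0 mulr0.
- move=> x y [d [Ad d0 Ix]] [e [Ae e0 Iy]]; exists (d * e).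
  rewrite rpredM // mulf_neq0 // mulrDr; split=> //; apply: ID.
    by rewrite mulrAC mulrC; apply: IM.
  by rewrite -mulrA; apply: IM.
- move=> x k Ix /Kc_frac[d [Ad d0 Adk]]; exists d; split=> //.
  by rewrite mulrCA mulrC; apply: IM.
Qed.

(** As I is a module over AX, [I KX = I Kc]. So 1 lies in [I Kc], and clearing its denominator gives
    an element of I. *)
Lemma denominator (B : subringClosed L) (I : set L) : {subset AX <= B} ->
    submodule B I -> mulset I (ring_set KX) = ring_set KX ->
  exists d, [/\ d \in A, d != 0 & I d].
Proof.
move=> AXB sI IK; have : ring_set KX 1 by apply: rpred1.
rewrite -IK KXE mulsetA (mulset_idr (submodule_sub AXB sI)).
have AB : {subset A <= B} by move=> x /AAX/AXB.
move=> /(mulset_denominator (submodule_sub AB sI))[d [Ad d0]].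
by rewrite mulr1; exists d.
Qed.

Lemma invN_extendK (B : subringClosed L) (I : inv_ideals B) : {subset B <= KX} ->
  mulset (sval I) (ring_set KX) = ring_set KX ->
  mulset (sval (- I)) (ring_set KX) = ring_set KX.
Proof.
move=> BK eI; rewrite -eI mulsetA.
by rewrite -inv_idealsD addNr mulset_extend.
Qed.

Lemma normalize (B : subringClosed L) (I : inv_ideals B) : {subset AX <= B} -> {subset B <= KX} ->
  exists2 I' : inv_ideals B, mulset (sval I') (ring_set KX) = ring_set KX
    & exists2 u, u != 0 & sval I = mulset [set u] (sval I').
Proof.
move=> AXB BK; have [u u0 eu] := KX_Pic (invertible_extend BK (inv_idealsP I)).
(* This d makes [u^-1 B] a fractional ideal of B. *)
have [d [Ad d0 Adu]] := L_frac u^-1.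
have iu : invertible_ideal B (mulset [set u^-1] (ring_set B)).
  by apply: (invertible_principal (d := d)); rewrite ?invr_eq0 // AXB.
have sI := submodule_inv I.
have eI : sval (mk_inv iu + I) = mulset [set u^-1] (sval I).
  by rewrite inv_idealsD /= -mulsetA mulset_id.
exists (mk_inv iu + I).
  by rewrite eI -mulsetA [mulset (sval I) _]eu (@mulset1K _ KX) //; apply: submodule_ring.
exists u => //; rewrite eI -{1}[u]invrK; symmetry; apply: (@mulset1K _ B) => //.
by rewrite invr_eq0.
Qed.

Let TXKX j : {subset TX j <= KX}.
Proof.
suff : ring_set (TX j) `<=` ring_set KX by [].
by rewrite TXE KXE; apply: mulset_mono => // t; apply: TK.
Qed.

(** * The classes of the extensions I T[X] *)

Lemma mulset_TX I j : submodule AX I ->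
  mulset I (ring_set (TX j)) = mulset I (ring_set (T j)).
Proof. by move=> sI; rewrite TXE mulsetA (mulset_idr sI). Qed.

Let ext j (I : inv_ideals AX) : inv_ideals (TX j) := extend_ideal (@AXTX j) I.
Let cls j (I : inv_ideals (TX j)) : LPic (@TTX j) := LPic_class (@TTX j) I.

Let ext_scale j (I I' : inv_ideals AX) (u : L) : u != 0 ->
  sval I = mulset [set u] (sval I') -> cls (ext j I) = cls (ext j I').
Proof.
move=> u0 eI; apply: (LPic_class_scale _ u0).
by rewrite [LHS]/= eI -mulsetA.
Qed.

(** The last two conditions put [TX j] inside both [I TX] and [N TX], which are inverse to each
    other. N is kept apart from [- I] because [ext_surj_at] produces the inverse as an explicit
    intersection. *)
Lemma ext_eq0 j (I : inv_ideals AX) N : submodule AX N ->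
    mulset (sval I) N = ring_set AX ->
    mulset (sval I) (ring_set (T j)) 1 -> mulset N (ring_set (T j)) 1 ->
  ext j I = 0.
Proof.
move=> sN IN; rewrite -(mulset_TX j (submodule_inv I)) -(mulset_TX j sN) => I1 N1.
have sTX := submodule_ring (TX j).
have sub M : mulset M (ring_set (TX j)) 1 -> ring_set (TX j) `<=` mulset M (ring_set (TX j)).
  by move=> M1 x TXx; rewrite -[x]mul1r -(mulset_ring (TX j)) mulsetA; apply: mulset_mem.
apply: val_inj; symmetry.
apply: (@inv_ideals_sub_eq _ (TX j) _ _ (ring_set (TX j)) (mulset N (ring_set (TX j)))) => //.
- exact: submodule_inv.
- exact: sub.
- exact: sub.
- exact: mulset_ring.
- by rewrite mulsetACA IN mulset_ring mulset_extend.
Qed.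

Lemma finite_support_ext (I : inv_ideals AX) : finite_set [set j | cls (ext j I) != 0].
Proof.
have [I' I'K [u u0 eI]] := normalize I (fun x h => h) AXKX.
have AXAX : {subset AX <= AX} by [].
have [d [Ad d0 Id]] := denominator AXAX (submodule_inv I') I'K.
have [d' [Ad' d'0 Id']] := denominator AXAX (submodule_inv (- I')) (invN_extendK AXKX I'K).
have fin : finite_set ([set j | d^-1 \notin T j] `|` [set j | d'^-1 \notin T j]).
  by rewrite finite_setU; split; apply: T_finite.
apply: sub_finite_set fin => j /=; rewrite (ext_scale _ u0 eI); apply: contra_neqP.
move=> /not_orP[/negP/negPn Td /negP/negPn Td'].
suff -> : ext j I' = 0 by rewrite /cls raddf0.
apply: (ext_eq0 (submodule_inv (- I')) (mulset_invN I')).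
  by rewrite -(divff d0); apply: mulset_mem.
by rewrite -(divff d'0); apply: mulset_mem.
Qed.

(** * The kernel *)

Lemma inv_ideals_subK j (P : inv_ideals (T j)) : sval P `<=` ring_set Kc.
Proof.
have [[_ [d [Td d0 dP]]] _] := inv_idealsP P => x Px.
have : d^-1 * (d * x) \in Kc.
  by apply: rpredM; [apply: KcV; apply: TK Td|apply: TK (dP _ Px)].
by rewrite mulKf.
Qed.

Lemma inv_ideals_extendK j (P : inv_ideals (T j)) :
  mulset (sval P) (ring_set KX) = ring_set KX.
Proof.
have sub (Q : inv_ideals (T j)) : mulset (sval Q) (ring_set KX) `<=` ring_set KX.
  rewrite -{2}(mulset_ring KX); apply: mulset_mono => // x /inv_ideals_subK Kx.
  suff : ring_set KX x by []; rewrite KXE -[x]mul1r.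
  by apply: mulset_mem => //; apply: rpred1.
apply/seteqP; split; first exact: sub.
have TKX : {subset T j <= KX} by move=> x /(@TTX j); apply: TXKX.
rewrite -{1}(mulset_extend TKX) -(mulset_invN P) -mulsetA.
by apply: mulset_mono => //; apply: sub.
Qed.

(** Triviality of the class gives [I TX = u P TX] with P an ideal of T. Both [I KX] and [P KX] equal
    KX, so u is a unit of KX, hence a constant. Then [u P] and [u^-1 P^-1] consist of constants and
    generate [I TX] and [I^-1 TX]. *)
Lemma constant_component j (I : inv_ideals AX) :
    mulset (sval I) (ring_set KX) = ring_set KX -> cls (ext j I) = 0 ->
  exists M N : set L,
  [/\ M `<=` ring_set Kc, N `<=` ring_set Kc, mulset M N 1,
      M `<=` mulset (sval I) (ring_set (T j))
    & N `<=` mulset (sval (- I)) (ring_set (T j))].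
Proof.
move=> IK /LPic_class_eq0[u u0 [P eP]].
have uK : mulset [set u] (ring_set KX) = ring_set KX.
  rewrite -{1}(inv_ideals_extendK P) -{1}(mulset_extend (@TXKX j)) [in X in mulset _ X]mulsetA.
  by rewrite mulsetA -eP -mulsetA mulset_extend.
have sKX := submodule_ring KX.
have Ku : u \in Kc.
  have : ring_set KX u.
    by rewrite -uK -[X in _ X]mulr1; apply: mulset_mem => //; apply: rpred1.
  move=> KXu; apply: KX_unit => //; have : ring_set KX 1 by apply: rpred1.
  rewrite -{1}uK (mulset1E _ sKX) => -[x KXx ux1].
  by rewrite -[u^-1]mulr1 -ux1 mulKf.
pose M := mulset [set u] (sval P); pose N := mulset [set u^-1] (sval (- P)).
have NM : mulset N M = ring_set (T j).
  rewrite mulsetACA (mulsetC (sval (- P))) mulset_invN -mulsetA (@mulset1K _ (T j)) //.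
  exact: submodule_ring.
have subK (Q : inv_ideals (T j)) v : v \in Kc -> mulset [set v] (sval Q) `<=` ring_set Kc.
  move=> Kv; rewrite -(mulset_ring Kc); apply: mulset_mono => [_ -> //|].
  exact: inv_ideals_subK.
have eM : mulset M (ring_set (TX j)) = sval (ext j I) by rewrite eP mulsetA.
have eN : mulset N (ring_set (TX j)) = sval (ext j (- I)).
  have eTX : mulset (sval (ext j I)) (sval (ext j (- I))) = ring_set (TX j).
    by rewrite -inv_idealsD -raddfD subrr raddf0.
  rewrite -eTX -eM -(mulsetA M) (mulsetA N M) NM mulsetA (mulset_extend (@TTX j)).
  exact/mulset_id/submodule_inv.
have sub Q (I' : inv_ideals AX) : mulset Q (ring_set (TX j)) = sval (ext j I') ->
    Q `<=` mulset (sval I') (ring_set (T j)).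
  rewrite -(mulset_TX j (submodule_inv I')) => eQ x Qx.
  suff : sval (ext j I') x by []; rewrite -eQ -[x]mulr1.
  by apply: mulset_mem => //; apply: rpred1.
exists M, N; split; [exact: subK|by apply: subK; apply: KcV| |exact: sub|exact: sub].
by rewrite mulsetC NM; apply: rpred1.
Qed.

(** A nonzero y in N sends M into A; the factor d only moves the multiplier y itself from Kc into
    A. *)
Lemma fractional_of_mul M N :
    submodule A M -> submodule A N -> N `<=` ring_set Kc ->
  mulset M N = ring_set A -> fractional_ideal A M.
Proof.
move=> sM [N0 ND NM] NK MN; split=> //.
have [y Ny y0] : exists2 y, N y & y != 0.
  apply: contrapT => noy; have : ring_set A 1 by apply: rpred1.
  rewrite -MN; suff sub : mulset M N `<=` [set 0].
    by move/sub/eqP; rewrite oner_eq0.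
  apply: mulset_min => //= [x y -> ->|x y _ Ny]; first by rewrite addr0.
  by apply/eqP; rewrite mulf_eq0; apply/orP; right; apply: contraT => y0; case: noy; exists y.
have [d [Ad d0 Ady]] := Kc_frac (NK _ Ny).
exists (d * y); split; rewrite ?mulf_neq0 // => x Mx.
suff : ring_set A (d * y * x) by [].
by rewrite -MN mulrC; apply: mulset_mem => //; apply: NM.
Qed.

Lemma class_eq0_local (I : inv_ideals AX) :
  LPic_class AAX I = 0 <-> forall j, cls (ext j I) = 0.
Proof.
split=> [/LPic_class_eq0[u u0 [M eI]] j|].
  apply/LPic_class_eq0; exists u => //; exists (extend_ideal (@AT j) M).
  rewrite [LHS]/= eI -!mulsetA; congr mulset; congr mulset.
  by rewrite !mulset_extend.
have [I' I'K [u u0 eI]] := normalize I (fun x h => h) AXKX.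
rewrite (LPic_class_scale _ u0 eI) => cls0.
have {}cls0 j : cls (ext j I') = 0 by rewrite -(ext_scale _ u0 eI).
pose M := [set x | sval I' x /\ x \in Kc]; pose N := [set x | sval (- I') x /\ x \in Kc].
have sMN (P : inv_ideals AX) : submodule A [set x | sval P x /\ x \in Kc].
  exact/submodule_capK/(submodule_sub AAX)/submodule_inv.
have sM : submodule A M := sMN I'; have sN : submodule A N := sMN (- I').
have MN : mulset M N = ring_set A.
  have MNA : mulset M N `<=` ring_set A.
    have [A0 AD _] := submodule_ring A; apply: mulset_min => // x y [Ix Kx] [Iy Ky].
    apply: AXK; last exact: rpredM.
    suff : ring_set AX (x * y) by [].
    by rewrite -(mulset_invN I'); apply: mulset_mem.
  have [_ _ MNM] := submodule_mul N sM.
  apply/seteqP; split=> // a Aa; rewrite -[a]mulr1; apply: MNM => //.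
  (* It is enough that 1 lies in [M N], and completeness reduces this to each [T j], where 1 lies in
     [M' N']. *)
  apply: T_complete => // [|j]; first exact: submodule_mul.
  have [M' [N' [M'K N'K MN1 M'I N'I]]] := constant_component I'K (cls0 j).
  (* Intersection with Kc commutes with extension to [T j]: a denominator e of a constant x puts
     [e * x] in P, and [e * x] is still a constant. *)
  have sub (P : inv_ideals AX) Q : Q `<=` ring_set Kc ->
      Q `<=` mulset (sval P) (ring_set (T j)) ->
      Q `<=` mulset [set x | sval P x /\ x \in Kc] (ring_set (T j)).
    move=> QK QP x Qx; have sP := submodule_sub AAX (submodule_inv P).
    apply: comax_mem (comax_denominators sP (QP _ Qx)) _ => e [Ae Pe]; split=> //.
    by apply: rpredM; [exact: AK|exact: QK].
  rewrite -(mulset_ring (T j)) mulsetACA.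
  by apply: mulset_mono MN1; apply: sub.
have invM : invertible_ideal A M.
  split; first by apply: fractional_of_mul MN => // x [].
  by exists N => //; rewrite mulsetC in MN; apply: fractional_of_mul MN => // x [].
apply/LPic_class_eq0; exists 1; first exact: oner_neq0.
exists (mk_inv invM); rewrite /= (@mulset1E _ AX); last first.
  exact/submodule_mulr/submodule_ring.
have eI' : mulset M (ring_set AX) = sval I'.
  have sub (P : inv_ideals AX) :
      mulset [set x | sval P x /\ x \in Kc] (ring_set AX) `<=` sval P.
    rewrite -{2}(mulset_idr (submodule_inv P)); apply: mulset_mono => // x; by case.
  apply: (@inv_ideals_sub_eq _ AX _ _ (mulset N (ring_set AX)) (sval (- I'))).
  - exact: submodule_inv.
  - exact: sub.
  - exact: sub.
  - by rewrite mulsetACA MN mulset_ring mulset_extend.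
  - exact: mulset_invN.
  - exact/submodule_mulr/submodule_ring.
rewrite eI'; apply/seteqP; split=> [x Ix|_ [x Ix <-]]; last by rewrite mul1r.
by exists x; rewrite ?mul1r.
Qed.

(** * The image *)

Lemma ext_surj_at i (I0 : inv_ideals (TX i)) : exists I : inv_ideals AX,
  cls (ext i I) = cls I0 /\ forall j, j != i -> cls (ext j I) = 0.
Proof.
have [P PK [u u0 eI]] := normalize I0 (@AXTX i) (@TXKX i).
rewrite [cls I0](LPic_class_scale _ u0 eI) => {I0 u u0 eI}.
(* The construction is applied to P and to [- P] alike; the two results turn out to be inverse to
   each other. *)
pose cap (Q : inv_ideals (TX i)) :=
  [set x | [/\ sval Q x, x \in KX & forall j, j != i -> x \in TX j]].
have capM (Q : inv_ideals (TX i)) : submodule AX (cap Q).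
  have [Q0 QD QM] := submodule_inv Q; split.
  - by split=> // *; rewrite rpred0.
  - move=> x y [Qx Kx Tx] [Qy Ky Ty]; split; [exact: QD|exact: rpredD|].
    by move=> j ji; rewrite rpredD ?Tx ?Ty.
  - move=> a x Aa [Qx Kx Tx]; split; [by apply: QM => //; apply: AXTX| |].
      by rewrite rpredM // AXKX.
    by move=> j ji; rewrite rpredM ?Tx // AXTX.
have denom (Q : inv_ideals (TX i)) : mulset (sval Q) (ring_set KX) = ring_set KX ->
    exists d, [/\ d \in A, d != 0 & cap Q d].
  move=> /(denominator (@AXTX i) (submodule_inv Q))[d [Ad d0 Qd]].
  exists d; split=> //; split=> // [|j _]; first exact/AXKX/AAX.
  exact/AXTX/AAX.
have NK := invN_extendK (@TXKX i) PK.
have [d [Ad d0 Pd]] := denom P PK.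
have [d' [Ad' d'0 Nd']] := denom (- P) NK.
(* If e in A has [e / c] in [T i], then [e = (e / c) * c] lies in Q and, being in A, in every
   [TX k]. *)
have locj (Q : inv_ideals (TX i)) c j : c \in A -> c != 0 -> cap Q c -> j != i ->
    mulset (cap Q) (ring_set (T j)) 1.
  move=> Ac c0 [Qc KXc TXc] ji; have ij : i != j by rewrite eq_sym.
  apply: comax_mem (comax_indep ij Ac) _ => e [Ae Te]; rewrite mulr1.
  split; [|exact/AXKX/AAX|by move=> k _; apply/AXTX/AAX].
  have [_ _ QM] := submodule_inv Q.
  by rewrite -(divfK c0 e); apply: QM => //; apply: TTX.
(* Let c clear x into AX. If [e / c] lies in [T j] for all j other than i, then
   [e * x = (e / c) * (c * x)] lies in all those [TX j]. *)
have loci (Q : inv_ideals (TX i)) : mulset (sval Q) (ring_set KX) = ring_set KX ->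
    sval Q `<=` mulset (cap Q) (ring_set (T i)).
  move=> QK x Qx; have KXx : ring_set KX x.
    by rewrite -QK -[x]mulr1; apply: mulset_mem => //; apply: rpred1.
  have : mulset (ring_set AX) (ring_set Kc) x by rewrite -KXE.
  move=> /(mulset_denominator (submodule_sub AAX (submodule_ring AX)))[c [Ac c0 AXcx]].
  apply: comax_mem (comax_indep_all i Ac c0) _ => e [Ae Te].
  have [_ _ QM] := submodule_inv Q; split.
  - by apply: QM => //; apply/AXTX/AAX.
  - by apply: rpredM => //; apply/AXKX/AAX.
  - move=> j ji; rewrite -(divfK c0 e) -(mulrA (e / c)); apply: rpredM; first exact: TTX (Te _ ji).
    exact: AXTX.
have PN : mulset (cap P) (cap (- P)) = ring_set AX.
  apply/seteqP; split.
    have [AX0 AXD _] := submodule_ring AX.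
    apply: mulset_min => // x y [Px Kx Tx] [Ny Ky Ty].
    apply: TX_complete => [|j]; first exact: rpredM.
    have [->|ji] := eqVneq j i; last by rewrite rpredM ?Tx ?Ty.
    suff : ring_set (TX i) (x * y) by [].
    by rewrite -(mulset_invN P); apply: mulset_mem.
  have sPN := submodule_mul (cap (- P)) (capM P).
  have [PN0 PND PNM] := submodule_sub AAX sPN.
  have [_ _ PNMX] := sPN.
  (* Completeness concerns ideals of A, so it is applied to the contraction of the product to A;
     denominators of 1 then remove the contraction locally. *)
  suff [PN1 _] : [set x | mulset (cap P) (cap (- P)) x /\ x \in A] 1.
    by move=> x AXx; rewrite -[x]mulr1; apply: PNMX.
  apply: T_complete => [|x [] //|j].
    split=> [|x y [PNx Ax] [PNy Ay]|a x Aa [PNx Ax]].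
    - by rewrite /= rpred0.
    - by split; [exact: PND|exact: rpredD].
    - by split; [exact: PNM|exact: rpredM].
  suff PN1 : mulset (mulset (cap P) (cap (- P))) (ring_set (T j)) 1.
    apply: comax_mem (comax_denominators (submodule_sub AAX sPN) PN1) _ => e [Ae].
    by rewrite mulr1.
  have [->|ji] := eqVneq j i; last first.
    by apply: comax_mul; [apply: locj Ad d0 Pd ji|apply: locj Ad' d'0 Nd' ji].
  have : ring_set (TX i) 1 by apply: rpred1.
  rewrite -(mulset_invN P) -(mulset_ring (T i)) mulsetACA.
  by apply: mulset_mono; apply: loci.
have frac (M N : set L) c : submodule AX M -> c \in A -> c != 0 -> N c ->
    mulset M N = ring_set AX -> fractional_ideal AX M.
  move=> sM Ac c0 Nc MN; split=> //; exists c; split=> // [|x Mx]; first exact: AAX.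
  suff : ring_set AX (c * x) by [].
  by rewrite -MN mulrC; apply: mulset_mem.
have invP : invertible_ideal AX (cap P).
  split; first exact: frac Ad' d'0 Nd' PN.
  by exists (cap (- P)) => //; apply: frac Ad d0 Pd _ => //; rewrite mulsetC.
exists (mk_inv invP); split=> [|j ji]; last first.
  rewrite (ext_eq0 (I := mk_inv invP) (capM (- P)) PN) ?/cls ?raddf0 //.
    exact: locj Ad d0 Pd ji.
  exact: locj Ad' d'0 Nd' ji.
congr LPic_class; apply: val_inj.
have sub (Q : inv_ideals (TX i)) : mulset (cap Q) (ring_set (TX i)) `<=` sval Q.
  rewrite -{1}(mulset_idr (submodule_inv Q)); apply: mulset_mono => // x.
  by case.
apply: (@inv_ideals_sub_eq _ (TX i) _ _ (mulset (cap (- P)) (ring_set (TX i))) (sval (- P))).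
- exact: submodule_inv.
- exact: sub.
- exact: sub.
- by rewrite mulsetACA PN mulset_ring mulset_extend.
- exact: mulset_invN.
- exact/submodule_mulr/submodule_ring.
Qed.

Theorem LPic_dsum :
  exists phi : {additive LPic AAX -> dsum (fun j => LPic (@TTX j))}, bijective phi.
Proof.
pose G j := LPic (@TTX j).
pose f I : dsum G := exist _ ((fun j => cls (ext j I)) : dprod G) (asboolT (finite_support_ext I)).
have fB : zmod_morphism f.
  move=> I I'; apply: val_inj; apply: functional_extensionality_dep => j.
  have extB : ext j (I - I') = ext j I - ext j I' by apply: raddfB.
  by rewrite [LHS]/(cls _) extB; apply: raddfB.
pose F : {additive inv_ideals AX -> dsum G} :=
  HB.pack f (GRing.isZmodMorphism.Build _ _ f fB).
apply: (@additive_lift_bij _ _ _ (LPic_class AAX) F) => [c|g|I].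
- exact: LPic_class_surj.
- have /asboolP/finite_seqP[s es] := valP g.
  have {es} : forall j, j \notin s -> val g j = 0.
    move=> j js; apply: contraNeq js => gj; have : [set` s] j by rewrite -es.
    by [].
  (* Induction on a list containing the support: subtracting [F I] kills the component at i and does
     not change the others. *)
  elim: s g => [|i s IH] g g0.
    exists 0; rewrite raddf0; apply: val_inj; apply: functional_extensionality_dep => j.
    by rewrite [RHS]g0.
  have [I0 eI0] := LPic_class_surj (val g i : LPic (@TTX i)).
  have [I [Ii Ij]] := ext_surj_at I0.
  have [|I' eI'] := IH (g - F I).
    move=> j js; rewrite [LHS](_ : _ = val g j - cls (ext j I)) //.
    have [e|ji] := eqVneq j i; first by rewrite e Ii -eI0 subrr.
    by rewrite Ij // subr0 g0 // inE (negPf ji).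
  by exists (I' + I); rewrite raddfD eI' subrK.
- rewrite class_eq0_local; split=> [f0|].
    by apply: val_inj; apply: functional_extensionality_dep => j; apply: f0.
  by move=> /(congr1 val) f0 j; rewrite -[LHS]/(val (F I) j) f0.
Qed.

End Jaffard.

(** * GCD domains *)

Definition divides (R : nzRingType) (a b : R) := exists c, b = c * a.

Definition gcd_domain (R : idomainType) := forall a b : R, exists g,
  [/\ divides g a, divides g b
    & forall d, divides d a -> divides d b -> divides d g].

Section Divides.
Variable R : idomainType.
Implicit Types a b c d : R.

Lemma divides_refl a : divides a a.
Proof. by exists 1; rewrite mul1r. Qed.

Lemma divides0 a : divides a 0.
Proof. by exists 0; rewrite mul0r. Qed.

Lemma divides_trans b a c : divides a b -> divides b c -> divides a c.
Proof. by move=> [x ->] [y ->]; exists (y * x); rewrite mulrA. Qed.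

Lemma divides_mull a b c : divides a b -> divides a (c * b).
Proof. by move=> [x ->]; exists (c * x); rewrite mulrA. Qed.

Lemma divides_mulr a b c : divides a b -> divides a (b * c).
Proof. by rewrite mulrC; apply: divides_mull. Qed.

Lemma dividesB a b c : divides a b -> divides a c -> divides a (b - c).
Proof. by move=> [x ->] [y ->]; exists (x - y); rewrite mulrBl. Qed.

Lemma dividesD a b c : divides a b -> divides a c -> divides a (b + c).
Proof. by move=> [x ->] [y ->]; exists (x + y); rewrite mulrDl. Qed.

Lemma divides_mul2l c a b : c != 0 -> divides (c * a) (c * b) -> divides a b.
Proof. by move=> c0 [x]; rewrite mulrCA => /(mulfI c0) ->; exists x. Qed.

Lemma divides_mul a b c d : divides a b -> divides c d -> divides (a * c) (b * d).
Proof. by move=> [x ->] [y ->]; exists (x * y); rewrite mulrACA. Qed.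

Hypothesis gcdR : gcd_domain R.

(** The gcd of [a * x] and [a * y] is a multiple [h * a], and h divides x and y, hence g. *)
Lemma gcd_mulr b x y g a :
  (forall d, divides d x -> divides d y -> divides d g) ->
  divides b (x * a) -> divides b (y * a) -> divides b (g * a).
Proof.
move=> gM bx by_; have [->|a0] := eqVneq a 0; first by rewrite mulr0; apply: divides0.
have [G [Gx Gy GM]] := gcdR (a * x) (a * y).
have [h eG] : divides a G by apply: GM; exists x + exists y; rewrite mulrC.
have hg : divides h g.
  by apply: gM; apply: (divides_mul2l a0); rewrite mulrC -eG.
have bG : divides b G by apply: GM; rewrite mulrC.
apply: (divides_trans bG); rewrite eG.
exact: divides_mul hg (divides_refl a).
Qed.

(** The free factor a in the universal property is what [gcd_domain_gens] needs. *)
Lemma gcd_seq (s : seq R) : exists g,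
  (forall x, x \in s -> divides g x) /\
  forall a b, (forall x, x \in s -> divides b (x * a)) -> divides b (g * a).
Proof.
elim: s => [|x s [g [gs gM]]].
  by exists 0; split=> // a b _; rewrite mul0r; apply: divides0.
have [h [hx hg hM]] := gcdR x g; exists h; split=> [y|a b bs].
  by rewrite inE => /orP[/eqP ->//|/gs]; apply: divides_trans.
apply: (gcd_mulr hM); first by apply: bs; rewrite mem_head.
by apply: gM => y ys; apply: bs; rewrite inE ys orbT.
Qed.

Lemma coprime_divides d a b :
  (forall e, divides e d -> divides e a -> divides e 1) ->
  divides d (a * b) -> divides d b.
Proof.
move=> cop dab; rewrite -[b]mul1r; apply: (gcd_mulr cop) => //.
by exists b; rewrite mulrC.
Qed.

(** * Contents and Gauss's lemma *)

Definition primitive (p : {poly R}) := forall d, (forall i, divides d p`_i) -> divides d 1.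

Lemma primitive_neq0 p : primitive p -> p != 0.
Proof.
move=> pp; apply/eqP => p0; have [i|c] := pp 0.
  by rewrite p0 coef0; apply: divides0.
by rewrite mulr0 => /eqP; rewrite oner_eq0.
Qed.

Lemma primitive_part p : p != 0 -> exists c q, [/\ c != 0, primitive q & p = c *: q].
Proof.
move=> p0; have [c [cp cM]] := gcd_seq p.
have cpi i : divides c p`_i.
  have [ip|ip] := ltnP i (size p); first exact/cp/mem_nth.
  by rewrite nth_default //; apply: divides0.
have {cp} [q pq] : exists q : {poly R}, p = c *: q.
  exists (\poly_(i < size p) projT1 (cid (cpi i))).
  apply/polyP => i; rewrite coefZ coef_poly; case: ltnP => ip.
    by case: (cid _) => x /= ->; rewrite mulrC.
  by rewrite mulr0 nth_default.
have c0 : c != 0 by apply: contraNneq p0 => c0; rewrite pq c0 scale0r.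
exists c, q; split=> // d dq; apply: (divides_mul2l c0); rewrite mulr1.
rewrite -[X in divides _ X]mulr1; apply: cM => x /(nthP 0)[i _ <-].
rewrite mulr1 pq coefZ; exact: divides_mul (divides_refl c) (dq i).
Qed.

(** Divide d and c by their gcd: the cofactor x of d is coprime to that of c, so it divides every
    coefficient of p and is a unit. *)
Lemma divides_primitive p c d :
  primitive p -> (forall i, divides d (c * p`_i)) -> divides d c.
Proof.
move=> pp dcp; have [g [[x ed] [y ec] gM]] := gcdR d c.
have [g0|g0] := eqVneq g 0.
  by rewrite ed ec g0 !mulr0; apply: divides0.
suff x1 : divides x 1.
  apply: (@divides_trans g); last by exists y.
  by rewrite ed -[X in divides _ X]mul1r; apply: divides_mul => //; apply: divides_refl.
apply: pp => i; apply: (@coprime_divides x y) => [e ex ey|].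
  have : divides (g * e) (g * 1).
    rewrite mulr1; apply: gM; rewrite ?ed ?ec mulrC;
      by apply: divides_mul => //; apply: divides_refl.
  exact: divides_mul2l.
apply: (divides_mul2l g0); rewrite mulrA (mulrC g y) -ec (mulrC g) -ed //.
Qed.

(** Gauss's lemma without prime elements, of which a GCD domain may have too few; the induction is
    on the sum of the sizes. *)
Lemma primitiveM p q : primitive p -> primitive q -> primitive (p * q).
Proof.
have [n] := ubnP (size p + size q)%N; elim: n p q => // n IH p q ltn pp pq d dpq.
(* If e divides [f * g] and the leading coefficient of f, it divides [r * g] for the tail r of f.
   Write [r = c *: s] with s primitive: [s * g] is primitive by induction, so e divides c, hence r,
   hence f. *)
have lead : forall f g : {poly R}, (size f + size g < n.+1)%N -> primitive f -> primitive g ->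
    forall e, (forall i, divides e (f * g)`_i) -> divides e (lead_coef f) -> divides e 1.
  move=> {p q pp pq d dpq ltn} p q ltn pp pq e epq ep.
  have p0 := primitive_neq0 pp.
  pose r := p - lead_coef p *: 'X^((size p).-1).
  have er i : divides e (r * q)`_i.
    rewrite mulrBl coefB; apply: dividesB => //.
    by rewrite -scalerAl coefZ; apply: divides_mulr.
  have rp : (size r < size p)%N.
    rewrite -(prednK (_ : 0 < size p)%N) ?size_poly_gt0 // ltnS; apply/leq_sizeP => i.
    rewrite leq_eqVlt => /orP[/eqP <-|lti]; rewrite coefB coefZ coefXn.
      by rewrite eqxx mulr1 lead_coefE subrr.
    rewrite gtn_eqF // mulr0 subr0 nth_default //.
    by rewrite -(prednK (_ : 0 < size p)%N) ?size_poly_gt0.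
  apply: pp => i; rewrite -[p](subrK (lead_coef p *: 'X^((size p).-1))) -/r coefD coefZ.
  apply: dividesD; last exact: divides_mulr.
  have [->|r0] := eqVneq r 0; first by rewrite coef0; apply: divides0.
  have [c [s [c0 ps rs]]] := primitive_part r0.
  have psq : primitive (s * q).
    apply: IH => //; rewrite -ltnS; apply: (leq_trans _ ltn); rewrite ltnS -addSn leq_add2r.
    by rewrite -(size_scale s c0) -rs.
  rewrite rs coefZ; apply: divides_mulr; apply: (divides_primitive psq) => j.
  by have := er j; rewrite rs -scalerAl coefZ.
(* By [lead], d is coprime to the leading coefficient of p. It divides the product of both leading
   coefficients, hence that of q, and [lead] for q and p applies. *)
have cop := lead q p; rewrite addnC mulrC in cop.
have cop' := cop ltn pq pp.
apply: (cop' d) => //; apply: (@coprime_divides d (lead_coef p)) => [e ed ep|].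
  by apply: (lead p q) ep => // i; apply: divides_trans (dpq i).
by rewrite -lead_coefM lead_coefE.
Qed.

(** Divisibility over the fraction field descends to R: write [h = d *: k] with k primitive; [k * p]
    is primitive, so c divides d. *)
Lemma primitive_divides p q c : primitive p -> c != 0 -> divides p (c *: q) -> divides p q.
Proof.
move=> pp c0 [h e]; have [->|q0] := eqVneq q 0; first by exists 0; rewrite mul0r.
have h0 : h != 0.
  by apply: contraNneq q0 => h0; move/eqP: e; rewrite h0 mul0r scale_poly_eq0 (negPf c0).
have [d [k [d0 pk ek]]] := primitive_part h0.
have [x dx] : divides c d.
  apply: (divides_primitive (primitiveM pk pp)) => i.
  by rewrite -coefZ scalerAl -ek -e coefZ; apply/divides_mulr/divides_refl.
exists (x *: k); apply: (@mulfI _ c%:P); rewrite ?polyC_eq0 // !mul_polyC.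
rewrite e ek dx -!scalerAl scalerA.
by rewrite mulrC.
Qed.

End Divides.

(** [%|] and [gcdp] are taken up to nonzero scalars, that is, over the fraction field. The gcd is
    that of the contents times the primitive part of [gcdp f g], and [primitive_divides] removes the
    scalars. *)
Lemma gcd_domain_poly (R : idomainType) : gcd_domain R -> gcd_domain {poly R}.
Proof.
move=> gcdR p q.
have [->|p0] := eqVneq p 0.
  by exists q; split=> //; [exact: divides0|exact: divides_refl].
have [->|q0] := eqVneq q 0.
  by exists p; split=> //; [exact: divides_refl|exact: divides0].
have [a [f [a0 pf ep]]] := primitive_part gcdR p0.
have [b [g [b0 pg eq]]] := primitive_part gcdR q0.
have h0 : gcdp f g != 0 by rewrite gcdp_eq0 negb_and primitive_neq0.
have [c [h [c0 ph eh]]] := primitive_part gcdR h0.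
have hdvd k : gcdp f g %| k -> divides h k.
  move=> /Pdiv.Idomain.dvdpP[[x r] /= x0 e]; apply: (primitive_divides gcdR ph x0).
  by rewrite e eh; exists (c *: r); rewrite -scalerAr -scalerAl.
have [m [ma mb mM]] := gcdR a b.
have polyCM (x y : R) (k l : {poly R}) : divides x y -> divides k l -> divides (x *: k) (y *: l).
  move=> [u ->] [v ->]; exists (u *: v).
  by rewrite -scalerAl -scalerAr scalerA.
exists (m *: h); split.
- by rewrite ep; apply: polyCM => //; apply/hdvd/dvdp_gcdl.
- by rewrite eq; apply: polyCM => //; apply/hdvd/dvdp_gcdr.
move=> d [x ex] [y ey].
have d0 : d != 0 by apply: contraNneq p0 => d0; rewrite ex d0 mulr0.
have [w [k [w0 pk ek]]] := primitive_part gcdR d0.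
have wdvd e (l : {poly R}) z : primitive l -> e *: l = z * d -> divides w e.
  move=> pl el; apply: (divides_primitive gcdR pl) => i.
  by rewrite -coefZ el ek -scalerAr coefZ; apply/divides_mulr/divides_refl.
have kdvd e (l : {poly R}) z : e != 0 -> e *: l = z * d -> k %| l.
  move=> e0 el; apply/Pdiv.Idomain.dvdpP; exists (e, w *: z) => //=.
  by rewrite el ek -scalerAr scalerAl.
rewrite ek; apply: polyCM.
  by apply: mM; [apply: (wdvd _ _ x pf)|apply: (wdvd _ _ y pg)]; rewrite -?ep -?eq.
have : k %| gcdp f g.
  by rewrite dvdp_gcd (kdvd a f x) -?ep // (kdvd b g y) -?eq.
move=> /Pdiv.Idomain.dvdpP[[z r] /= z0]; rewrite eh scalerA => e.
by apply: (primitive_divides gcdR pk (mulf_neq0 z0 c0)); exists r.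
Qed.

Lemma gcd_domain_field (K : fieldType) : gcd_domain K.
Proof.
move=> a b; have [->|a0] := eqVneq a 0.
  by exists b; split=> //; [exact: divides0|exact: divides_refl].
by exists a; split=> //; [exact: divides_refl|exists (b / a); rewrite divfK].
Qed.

(** The [f i] generate an ideal I with inverse generated by the [a j / b]. The conclusion says that
    I lies in [d R] and [d I^-1] in R, so that [I = d R]. Equations between finitely many elements
    can be carried along ring morphisms. *)
Definition invertible_principal_gens (R : comNzRingType) :=
  forall m (f a : 'I_m -> R) (b : R) (h : 'I_m -> 'I_m -> R),
    (forall i j, f i * a j = b * h i j) -> \sum_i f i * a i = b -> b != 0 ->
  exists d (f' c : 'I_m -> R),
    (forall i, f i = d * f' i) /\ (forall j, d * a j = b * c j).

Lemma gcd_domain_gens (R : idomainType) : gcd_domain R -> invertible_principal_gens R.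
Proof.
move=> gcdR m f a b h fa sb b0.
have [d [df dM]] := gcd_seq gcdR [seq f i | i : 'I_m].
have df' i : divides d (f i) by apply/df/map_f; rewrite mem_enum.
have da j : divides b (d * a j).
  by apply: dM => _ /mapP[i _ ->]; exists (h i j); rewrite fa mulrC.
exists d, (fun i => projT1 (cid (df' i))), (fun j => projT1 (cid (da j))).
by split=> i; case: cid => x /= ->; rewrite mulrC.
Qed.

(** * Polynomials in finitely many variables *)

Lemma malgUM (X : choiceType) (K : comNzRingType) (a b : K) (m n : {cmonom X}) :
  << a *g m >> * << b *g n >> = << a * b *g mmul m n >> :> {malg K[{cmonom X}]}.
Proof. by rewrite malgM_def fgmulUU. Qed.

Lemma expcmnE (X : choiceType) (m : {cmonom X}) n i : expcmn m n i = (n * m i)%N.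
Proof.
case: n => [|n]; first by rewrite onecmE.
by rewrite /expcmn iteropS; elim: n => [|n IH] /=; rewrite ?mul1n // mulcmE IH.
Qed.

Lemma malgUX (X : choiceType) (K : comNzRingType) (m : {cmonom X}) n :
  << m >> ^+ n = << expcmn m n >> :> {malg K[{cmonom X}]}.
Proof.
elim: n => [|n IHn]; first by rewrite expr0.
have e : mmul m (expcmn m n) = expcmn m n.+1.
  by apply/eqP/cmP => i; rewrite cmM !expcmnE mulSn.
rewrite exprS IHn (malgUM 1 1) [1 * 1]mulr1 e; reflexivity.
Qed.

Section DropVariable.
Variables (X : choiceType) (K : fieldType) (R : comNzRingType).
Variables (alpha : {rmorphism {malg K[{cmonom X}]} -> R}) (v : X).

Definition drop_var (m : {cmonom X}) : {cmonom X} :=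
  divcm m (expcmn (ucm v) (m v)).

Lemma drop_varE m i : drop_var m i = if i == v then 0%N else m i.
Proof.
rewrite divcmE expcmnE ucmE eq_sym; case: eqP => [->|_].
  by rewrite muln1 subnn.
by rewrite muln0 subn0.
Qed.

Lemma drop_varM m1 m2 : drop_var (mmul m1 m2) = mmul (drop_var m1) (drop_var m2).
Proof. by apply/eqP/cmP => i; rewrite cmM !drop_varE cmM; case: eqP. Qed.

Lemma drop_var1 : drop_var (@mone _) = @mone _.
Proof. by apply/eqP/cmP => i; rewrite drop_varE cm1 if_same. Qed.

Definition drop_varX (m : {cmonom X}) : {poly R} :=
  (alpha << drop_var m >>)%:P * 'X^(m v).

Lemma drop_varX_morph :
  {morph drop_varX : x y / mmul x y >-> x * y} * (drop_varX (@mone _) = 1).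
Proof.
split=> [x y|].
  have e : << drop_var (mmul x y) >> =
      << drop_var x >> * << drop_var y >> :> {malg K[{cmonom X}]}.
    by rewrite (malgUM 1 1) mulr1 drop_varM.
  by rewrite /drop_varX e (rmorphM alpha) polyCM cmM exprD mulrACA.
by rewrite /drop_varX drop_var1 rmorph1 cm1 mulr1.
Qed.

HB.instance Definition _ :=
  isMultiplicative.Build {cmonom X} {poly R} drop_varX drop_varX_morph.

End DropVariable.

Section Retract.
Variables (X : choiceType) (K : fieldType).
Local Notation P := {malg K[{cmonom X}]}.

(* R is K with the variables of V adjoined one at a time; alpha kills the others. *)
Lemma finite_vars_retract (V : seq X) : exists (R : idomainType)
    (alpha : {rmorphism P -> R}) (beta : {rmorphism R -> P}),
  gcd_domain R /\ forall c (m : {cmonom X}), (forall i, m i != 0%N -> i \in V) ->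
    beta (alpha << c *g m >>) = << c *g m >>.
Proof.
elim: V => [|v V [R [alpha [beta [gcdR IH]]]]].
  pose a0 : {rmorphism P -> K} := mcoeff (@mone {cmonom X}).
  pose b0 : {rmorphism K -> P} := @mkmalgU {cmonom X} K (@mone _).
  exists K, a0, b0; split=> [|c m m0]; first exact: gcd_domain_field.
  suff : m = mone by move=> ->; exact: (congr1 b0 (malgCK c)).
  apply/eqP/cmP => i; rewrite cm1; apply/eqP; apply: contraT => /m0.
  by rewrite in_nil.
pose fK : {rmorphism K -> {poly R}} := polyC \o alpha \o @mkmalgU {cmonom X} K (@mone _).
(* alpha' sends v to 'X and reads the other variables through alpha; beta' evaluates 'X at v. *)
pose alpha' : {rmorphism P -> {poly R}} := mmap fK (drop_varX alpha v).
pose xv : P := << ucm v >>.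
pose beta' : {rmorphism {poly R} -> P} := horner_eval xv \o map_poly beta.
exists {poly R}, alpha', beta'; split=> [|c m mV]; first exact: gcd_domain_poly.
have cm : << c *g drop_var v m >> = << c *g mone >> * << drop_var v m >> :> P.
  rewrite (malgUM c 1) [c * 1]mulr1 mul1m; reflexivity.
have -> : alpha' << c *g m >> = (alpha << c *g drop_var v m >>)%:P * 'X^(m v).
  rewrite [LHS]mmapU [LHS]mulrA; congr (_ * _).
  by rewrite -[LHS]polyCM cm; congr polyC; symmetry; apply: (rmorphM alpha).
rewrite [LHS](_ : _ = (map_poly beta ((alpha << c *g drop_var v m >>)%:P * 'X^(m v))).[xv]) //.
rewrite rmorphM /= map_polyC map_polyXn hornerM hornerC hornerXn.
have IHc : beta (alpha << c *g drop_var v m >>) = << c *g drop_var v m >>.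
  apply: IH => i.
  rewrite drop_varE; have [//|iv] := eqVneq i v => mi.
  by have := mV i mi; rewrite inE (negPf iv).
rewrite [X in X * _](_ : _ = << c *g drop_var v m >>); last exact: IHc.
rewrite /xv malgUX (malgUM c 1) [c * 1]mulr1.
suff : mmul (drop_var v m) (expcmn (ucm v) (m v)) = m by move=> ->; reflexivity.
apply/eqP/cmP => i; rewrite cmM expcmnE drop_varE ucmE eq_sym.
by case: eqP => [->|]; rewrite ?muln1 ?muln0 ?addn0.
Qed.

(** Only finitely many variables occur in the data. On these [beta \o alpha] is the identity, so
    alpha keeps b nonzero and beta brings the solution found in R back. *)
Lemma malg_gens : invertible_principal_gens P.
Proof.
move=> m f a b h fa sb b0.
pose S := b :: [seq f i | i : 'I_m] ++ [seq a i | i : 'I_m]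
  ++ [seq h u.1 u.2 | u : 'I_m * 'I_m].
pose mvars (k : {cmonom X}) := enum_fset (finsupp (cmonom_val k)).
pose vars (p : P) := flatten [seq mvars k | k <- enum_fset (msupp p)].
pose V := flatten [seq vars p | p <- S].
have [R [alpha [beta [gcdR retr]]]] := finite_vars_retract V.
have baK p : p \in S -> beta (alpha p) = p.
  move=> pS; rewrite [p in LHS]monalgE !rmorph_sum /= [RHS]monalgE.
  apply: eq_big_seq => k kp; apply: retr => i ki; apply/flattenP.
  exists (vars p); first exact: (map_f vars).
  apply/flattenP; exists (mvars k); first exact: (map_f mvars).
  by rewrite -cmE_neq0.
have Sb : b \in S by rewrite mem_head.
have Sf i : f i \in S by rewrite inE mem_cat map_f ?orbT ?mem_enum.
have Sa i : a i \in S by rewrite inE !mem_cat map_f ?orbT ?mem_enum.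
have Sh i j : h i j \in S.
  by rewrite inE !mem_cat (map_f (fun u => h u.1 u.2) (_ : (i, j) \in _)) ?orbT ?mem_enum.
have [d [f' [c [df da]]]] := @gcd_domain_gens R gcdR m (alpha \o f) (alpha \o a) (alpha b)
  (fun i j => alpha (h i j)) (fun i j => etrans (esym (rmorphM alpha _ _))
    (etrans (congr1 alpha (fa i j)) (rmorphM alpha _ _)))
  (etrans (etrans (eq_bigr _ (fun i _ => esym (rmorphM alpha _ _)))
    (esym (rmorph_sum alpha _ _ _))) (congr1 alpha sb))
  (contra_neq (fun e => etrans (esym (baK b Sb)) (etrans (congr1 beta e) (rmorph0 beta))) b0).
exists (beta d), (beta \o f'), (beta \o c); split=> i /=.
  by rewrite -rmorphM -df /= baK.
by rewrite -(baK _ (Sa i)) -(baK _ Sb) -!rmorphM /= -da.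
Qed.

End Retract.

(** * Flat overrings *)

Lemma fraction_rep (R : idomainType) (x : {fraction R}) :
  exists n d : R, d != 0 /\ x = tofrac n / tofrac d.
Proof.
elim/quotW: x => r; exists \n_r, \d_r; split; first exact: denom_ratioP.
apply: (@mulIf _ (tofrac \d_r)); first by rewrite tofrac_eq0 denom_ratioP.
rewrite divfK; last by rewrite tofrac_eq0 denom_ratioP.
have fracE y : tofrac y = \pi_(FracField.type R) (Ratio y 1) by rewrite piE.
rewrite !fracE; set FR := FracField.type R.
rewrite [LHS](_ : _ = FracField.mul (\pi_FR r) (\pi_FR (Ratio \d_r 1))) //.
rewrite -FracField.pi_mul; apply/eqmodP; rewrite /= FracField.equivfE /FracField.mulf.
rewrite !numden_Ratio ?mulf_neq0 ?oner_neq0 ?denom_ratioP //.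
by rewrite !mulr1 mulrC.
Qed.

(** * Maps out of tensor products, and flatness *)

Section MalgExtend.
Variables (K : choiceType) (G V : zmodType) (f : K -> {additive G -> V}).
Implicit Type g : {malg G[K]}.

Definition malg_extend g : V := \sum_(k <- msupp g) f k g@_k.

Lemma malg_extendEw (d : {fset K}) g : (msupp g `<=` d)%fset ->
  malg_extend g = \sum_(k <- d) f k g@_k.
Proof.
by move=> le; rewrite [LHS](big_fset_incl _ le) => //= x xd /mcoeff_outdom ->; rewrite raddf0.
Qed.

Lemma malg_extendU c k : malg_extend << c *g k >> = f k c.
Proof. by rewrite (malg_extendEw msuppU_le) big_seq_fset1 mcoeffUU. Qed.

Lemma malg_extend_is_zmod_morphism : zmod_morphism malg_extend.
Proof.
move=> g h; rewrite !(@malg_extendEw (msupp g `|` msupp h)%fset);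
  rewrite ?fsubsetUl ?fsubsetUr ?msuppB_le //.
by rewrite -sumrB; apply: eq_bigr => k _; rewrite mcoeffB raddfB.
Qed.

HB.instance Definition _ :=
  GRing.isZmodMorphism.Build {malg G[K]} V malg_extend malg_extend_is_zmod_morphism.

End MalgExtend.

(** [tensor_map] acts on a chosen representative. It differs from z by a relation, and f, being
    linear, preserves relations. *)
Lemma tensor_map_eq0 (R : comNzRingType) (M N N' : lmodType R) (f : {linear N -> N'})
    (z : {malg int[(M * N)%type]}) :
  tensor_rel (malg_extend (fun u =>
    mkmalgU (u.1, f u.2) : {additive int -> {malg int[(M * N')%type]}}) z) ->
  tensor_map f (\pi_(tensor M N) z) = 0.
Proof.
pose F : {additive {malg int[(M * N)%type]} -> {malg int[(M * N')%type]}} :=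
  malg_extend (fun u => mkmalgU (u.1, f u.2) : {additive int -> {malg int[(M * N')%type]}}).
have FR t : tensor_rel t -> tensor_rel (F t).
  elim=> [|z1 z2 _ F1 _ F2|m m' n|m n n'|a m n].
  - by rewrite raddf0; constructor.
  - by rewrite raddfB; constructor.
  - rewrite !raddfB /= !malg_extendU /=; exact: tensor_relDl.
  - rewrite !raddfB /= !malg_extendU /= linearD; exact: tensor_relDr.
  - rewrite !raddfB /= !malg_extendU /= linearZ; exact: tensor_relZ.
move=> Fz; apply/eqP; rewrite -[0](raddf0 (\pi_(tensor M N'))) -Quotient.idealrBE subr0.
apply/asboolP; change (tensor_rel (F (repr (\pi_(tensor M N) z)))).
change (tensor_rel (F z)) in Fz.
(* [tensor_rel] is closed under differences, so a sum [x + F z] is written [x - (0 - F z)]. *)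
rewrite -[repr _](subrK z) raddfD -[F z]opprK -[- F z]sub0r.
apply: tensor_relB; last by apply: tensor_relB => //; constructor.
apply: FR; apply/asboolP; change (repr (\pi_(tensor M N) z) - z \in @tensor_null R M N).
by rewrite Quotient.idealrBE reprK.
Qed.

(** In the tensor product of M and R, a pair (s, c) equals (c s, 1), so the images of both tensors
    agree; flatness pulls this back along f. *)
Lemma flat_tensor_rel (R : comNzRingType) (M N : lmodType R) (f : {linear N -> R^o})
    (m m' : M) (n n' : N) :
  flat M -> injective f -> (f n : R) *: m = (f n' : R) *: m' ->
  tensor_rel (<< (m, n) >> - << (m', n') >> : {malg int[(M * N)%type]}).
Proof.
move=> flatM f_inj fmn; set z := _ - _.
pose F : {additive {malg int[(M * N)%type]} -> {malg int[(M * R^o)%type]}} :=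
  malg_extend (fun u => mkmalgU (u.1, f u.2) : {additive int -> {malg int[(M * R^o)%type]}}).
have Fz : tensor_rel (F z).
  have to1 (c : R) (s : M) :
      tensor_rel (<< (c *: s, 1 : R^o) >> - << (s, c : R^o) >> : {malg int[(M * R^o)%type]}).
    rewrite [c in << (s, c) >>](_ : _ = c *: (1 : R^o)); last by rewrite [RHS]mulr1.
    exact: tensor_relZ.
  have FU p : F << p >> = << (p.1, f p.2) >> by rewrite [LHS]malg_extendU.
  rewrite (raddfB F) !FU /=.
  have := tensor_relB (to1 (f n') m') (to1 (f n) m); rewrite fmn.
  by rewrite opprB addrC addrA subrK.
have pz : \pi_(tensor M N) z = \pi_(tensor M N) 0.
  apply: (flatM _ _ f f_inj); rewrite !tensor_map_eq0 //.
  rewrite (raddf0 F); exact: tensor_rel0.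
by move/eqP: pz; rewrite -Quotient.idealrBE subr0 => /asboolP.
Qed.

(** The universal property with values in V / H, without forming the quotient: w need only be
    bilinear modulo H. *)
Lemma tensor_rel_balanced (R : comNzRingType) (M N : lmodType R) (V : zmodType)
    (H : V -> Prop) (w : M -> N -> V) :
    H 0 -> (forall x y, H x -> H y -> H (x - y)) ->
    (forall m m' n, H (w (m + m') n - w m n - w m' n)) ->
    (forall m n n', H (w m (n + n') - w m n - w m n')) ->
    (forall a m n, H (w (a *: m) n - w m (a *: n))) ->
  forall m n m' n', tensor_rel (<< (m, n) >> - << (m', n') >> : {malg int[(M * N)%type]}) ->
  H (w m n - w m' n').
Proof.
move=> H0 HB wDl wDr wZ.
pose psi : {additive {malg int[(M * N)%type]} -> V} :=
  malg_extend (fun p => *~%R (w p.1 p.2) : {additive int -> V}).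
have psiU p q : psi << (p, q) >> = w p q by rewrite [LHS]malg_extendU; apply: mulr1z.
have psiH z : tensor_rel z -> H (psi z).
  elim=> [|z1 z2 _ Hz1 _ Hz2|m m' n|m n n'|c m n].
  - by rewrite raddf0.
  - by rewrite raddfB; apply: HB.
  - rewrite (raddfB psi) (raddfB psi) !psiU; exact: wDl.
  - rewrite (raddfB psi) (raddfB psi) !psiU; exact: wDr.
  - rewrite (raddfB psi) !psiU; exact: wZ.
move=> m n m' n' /psiH; rewrite (raddfB psi) !psiU; exact.
Qed.

Section TwoGenerated.
Variables (D : idomainType) (a b : D).

Definition ideal2_pred : {pred D^o} := fun x => `[< exists u v, x = u * a + v * b >].

Lemma ideal2_submod_closed : submod_closed ideal2_pred.
Proof.
split; first by apply/asboolP; exists 0, 0; rewrite !mul0r addr0.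
move=> c _ _ /asboolP[u [v ->]] /asboolP[u' [v' ->]]; apply/asboolP.
exists (c * u + u'), (c * v + v').
by rewrite [c *: _]mulrDr !mulrDl !mulrA addrACA.
Qed.

HB.instance Definition _ := GRing.isSubmodClosed.Build D D^o ideal2_pred ideal2_submod_closed.

Definition ideal2 := {x : D^o | x \in ideal2_pred}.

HB.instance Definition _ := SubChoice.on ideal2.
HB.instance Definition _ := [SubChoice_isSubZmodule of ideal2 by <:].
HB.instance Definition _ := [SubZmodule_isSubLmodule of ideal2 by <:].

Lemma ideal2P (x : ideal2) : exists u v, val x = u * a + v * b.
Proof. by case: x => x /= /asboolP. Qed.

End TwoGenerated.

Section FlatOverring.
Variables (D : idomainType) (T : overring D).
Local Notation K := {fraction D}.
Local Notation denoms t := [set x : K | x \in base_ring D /\ x * t \in base_ring D].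

(* With t = a / b, flatness turns t b = a into an equality t (x) b = 1 (x) a in
   the tensor product of T and the ideal (a, b); the map
   s (x) (u a + v b) |-> s u from it to T / (D : t) T sends both sides to 0 and 1. *)
Lemma flat_denominators : flat (overring_mod T) -> forall t, t \in T ->
  mulset (denoms t) (ring_set T) 1.
Proof.
move=> flatT t Tt; have [a [b [b0 et]]] := fraction_rep t.
have tb : t * tofrac b = tofrac a by rewrite et divfK // tofrac_eq0.
have sH : submodule T (mulset (denoms t) (ring_set T)).
  exact/submodule_mulr/submodule_ring.
set H := mulset _ _ in sH *; have [H0 HD HM] := sH.
have HN x : H x -> H (- x) by move=> Hx; rewrite -mulN1r; apply: HM => //; rewrite rpredN1.
(* [u a + v b = 0] means [u t = - v], so u is a denominator of t. Hence the choice of the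
   coefficient [xi] below is harmless modulo H. *)
have key u v s : u * a + v * b = 0 -> s \in T -> H (tofrac u * s).
  move=> uv Ts; apply: mulset_mem => //; split; first exact: overring_tofrac.
  suff -> : tofrac u * t = tofrac (- v) by apply: overring_tofrac.
  apply: (@mulIf _ (tofrac b)); first by rewrite tofrac_eq0.
  by rewrite -mulrA tb -!tofracM mulNr; congr tofrac; apply/eqP; rewrite -addr_eq0 uv.
pose N : lmodType D := ideal2 a b.
pose xi (n : N) : D := projT1 (cid (ideal2P n)).
have xiP (n : N) : exists v, val n = xi n * a + v * b.
  by rewrite /xi; case: (cid (ideal2P n)).
pose w (s : overring_mod T) (n : N) : K := tofrac (xi n) * val s.
have wDl m m' n : H (w (m + m') n - w m n - w m' n).
  by rewrite /w [val (_ + _)](_ : _ = val m + val m') // mulrDr -addrA -opprD subrr.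
have wDr m n n' : H (w m (n + n') - w m n - w m n').
  rewrite /w -!mulrBl -!tofracB.
  have [v ev] := xiP n; have [v' ev'] := xiP n'; have [v'' ev''] := xiP (n + n').
  apply: (@key _ (v'' - v - v')); last exact: valP.
  rewrite !mulrBl addrACA [X in X + _]addrACA -!opprD -ev'' -ev -ev'.
  by rewrite raddfD -addrA -opprD subrr.
have wZ c m n : H (w (c *: m) n - w m (c *: n)).
  rewrite /w; have -> : val (c *: m) = tofrac c * val m by [].
  have [v ev] := xiP n; have [v' ev'] := xiP (c *: n).
  rewrite mulrA -tofracM -mulrBl -tofracB.
  apply: (@key _ (v * c - v')); last exact: valP.
  rewrite !mulrBl addrACA -opprD -ev' linearZ /= ev [c *: _]mulrDr.
  rewrite [c * (_ * a)]mulrA [c * (v * b)]mulrA (mulrC (xi n)) (mulrC v).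
  by rewrite subrr.
have Na : a \in ideal2_pred a b by apply/asboolP; exists 1, 0; rewrite mul1r mul0r addr0.
have Nb : b \in ideal2_pred a b by apply/asboolP; exists 0, 1; rewrite mul1r mul0r add0r.
pose aN : N := exist _ a Na; pose bN : N := exist _ b Nb.
pose tT : overring_mod T := exist _ t Tt; pose oneT : overring_mod T := exist _ 1 (rpred1 T).
pose incl : {linear N -> D^o} := val.
have e : (incl bN : D) *: tT = (incl aN : D) *: oneT.
  by apply: val_inj; rewrite /= mulr1 -tb mulrC.
have := flat_tensor_rel flatT (val_inj : injective incl) e.
have HB x y : H x -> H y -> H (x - y) by move=> Hx Hy; apply: HD => //; apply: HN.
move=> /(tensor_rel_balanced H0 HB wDl wDr wZ); rewrite /w /= mulr1 => Hz.
(* Comparison with the obvious coefficients, 0 and 1 for b and 1 and 0 for a, puts [xi bN * t] and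
   [1 - xi aN] in H. *)
have [v ev] := xiP bN; have [v' ev'] := xiP aN; rewrite /= in ev ev'.
have Hb : H (tofrac (xi bN) * t).
  apply: (@key _ (v - 1)) => //; rewrite mulrBl mul1r addrA -ev.
  by rewrite subrr.
have Ha : H (tofrac (1 - xi aN) * 1).
  apply: (@key _ (- v')); last exact: rpred1.
  by rewrite mulrBl mul1r mulNr -addrA -opprD -ev' subrr.
have -> : 1 = tofrac (1 - xi aN) * 1 - (tofrac (xi bN) * t - tofrac (xi aN))
    + tofrac (xi bN) * t :> K.
  by rewrite mulr1 tofracB tofrac1 opprB addrA subrK subrK.
by apply: (HD) => //; apply: HD => //; apply: HN.
Qed.

End FlatOverring.

(** * Polynomial rings inside the field of rational functions *)

Section FullOverring.
Variable D : idomainType.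

(** K is made an overring of D so that K and K[X] are instances of [const_ring] and [polys_ring]. *)
Definition full_pred : {pred {fraction D}} := fun=> true.

Lemma full_subring_closed : subring_closed full_pred.
Proof. by []. Qed.

HB.instance Definition _ :=
  GRing.isSubringClosed.Build {fraction D} full_pred full_subring_closed.

Definition full_ring : overring D := @Overring D full_pred (fun=> isT).

End FullOverring.
Arguments full_ring D : clear implicits.

(** Write 1 as a sum of products [x_i y_i] with x_i in I and y_i in J; q and r clear the
    denominators of I and J, whence [b = q r] and the generator [u = d / q]. Any z in I is the sum
    of the [(z y_i) x_i] and each x_i is in [u B]; conversely u is the sum of the [(u y_i) x_i],
    where [u y_i = c_i]. *)
Lemma invertible_principal_of_gens (L : fieldType) (B : subringClosed L) :
    (forall m (f a : 'I_m -> L) (b : L),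
      (forall i, f i \in B) -> (forall i, a i \in B) -> b \in B -> b != 0 ->
      (forall i j, exists2 h, h \in B & f i * a j = b * h) ->
      \sum_i f i * a i = b ->
      exists d (f' c : 'I_m -> L), [/\ d \in B, forall i, f' i \in B, forall i, c i \in B,
        forall i, f i = d * f' i & forall j, d * a j = b * c j]) ->
  forall I, invertible_ideal B I ->
    exists2 u : L, u != 0 & I = mulset [set u] (ring_set B).
Proof.
move=> gens I [[sI [q [Bq q0 qI]]] [J [_ [r [Br r0 rJ]]] IJ]].
have : mulset I J 1 by rewrite IJ; apply: rpred1.
move=> [s sIJ s1]; pose x (i : 'I_(size s)) := s`_i.
have xI i : I (x i).1 by case: (sIJ (x i) (mem_nth _ (ltn_ord i))).
have xJ i : J (x i).2 by case: (sIJ (x i) (mem_nth _ (ltn_ord i))).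
have {s1 sIJ} x1 : 1 = \sum_i (x i).1 * (x i).2 by rewrite s1 (big_nth 0) big_mkord.
have IJB y z : I y -> J z -> y * z \in B.
  by move=> Iy Jz; suff : ring_set B (y * z) by []; rewrite -IJ; apply: mulset_mem.
have [||||||d [f' [c [Bd Bf' Bc fd da]]]] :=
  gens (size s) (fun i => q * (x i).1) (fun i => r * (x i).2) (q * r).
- by move=> i; apply: qI.
- by move=> i; apply: rJ.
- exact: rpredM.
- exact: mulf_neq0.
- by move=> i j; exists ((x i).1 * (x j).2); [exact: IJB|rewrite mulrACA].
- by rewrite -[RHS]mulr1 x1 mulr_sumr; apply: eq_bigr => i _; rewrite mulrACA.
have x1E i : (x i).1 = d / q * f' i.
  by apply: (mulfI q0); rewrite fd mulrA mulrCA mulfV // mulr1.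
have x2E i : d / q * (x i).2 = c i.
  apply: (mulfI (mulf_neq0 q0 r0)); rewrite -da -mulrA mulrCA.
  by rewrite [q * _]mulrA [q * _]mulrCA mulfV // mulr1 mulrCA.
exists (d / q).
  rewrite mulf_neq0 ?invr_eq0 //; apply: contraNneq (oner_neq0 L) => d0.
  by rewrite x1 big1 // => i _; rewrite x1E d0 !mul0r.
have [I0 ID IM] := sI; have sB := submodule_ring B.
have sum_mem (H : set L) (F : 'I_(size s) -> L) : submodule B H ->
    (forall i, H (F i)) -> H (\sum_i F i).
  by move=> [H0 HD _] HF; apply: (big_ind H).
apply/seteqP; split=> [z Iz|].
  rewrite -[z]mulr1 x1 mulr_sumr; apply: sum_mem => [|i]; first exact: submodule_mulr.
  rewrite mulrCA x1E -(mulrA (d / q)); apply: mulset_mem => //.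
  exact: (rpredM (Bf' i) (IJB _ _ Iz (xJ i))).
apply: mulset_min => // _ y -> By; rewrite mulrC; apply: (IM) => //.
rewrite -[X in I X]mulr1 x1 mulr_sumr; apply: sum_mem => // i.
by rewrite mulrCA x2E mulrC; apply: (IM).
Qed.

Section Concrete.
Variables (D : idomainType) (X : choiceType).
Local Notation K := {fraction D}.
Local Notation P := (polys X K).
Local Notation L := (ratfuns D X).
Implicit Types (T : overring D) (p q : P) (c : K).

Definition const (c : K) : L := tofrac (c%:MP : P).

Lemma constM : {morph const : x y / x * y}.
Proof. by move=> x y; rewrite /const -tofracM -(rmorphM malgC). Qed.

Lemma constD : {morph const : x y / x + y}.
Proof. by move=> x y; rewrite /const -tofracD -(raddfD malgC). Qed.

Lemma const1 : const 1 = 1.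
Proof. by rewrite /const tofrac1. Qed.

Lemma const0 : const 0 = 0.
Proof. by rewrite /const malgC0E tofrac0. Qed.

Lemma const_inj : injective const.
Proof. by move=> x y /eqP; rewrite tofrac_eq malgC_eq => /eqP. Qed.

Lemma const_eq0 c : (const c == 0) = (c == 0).
Proof. by rewrite -const0 (inj_eq const_inj). Qed.

Lemma constV c : (const c)^-1 = const c^-1.
Proof.
have [->|c0] := eqVneq c 0; first by rewrite invr0 const0 invr0.
apply: (@mulfI _ (const c)); first by rewrite const_eq0.
by rewrite -constM !mulfV ?const_eq0 // const1.
Qed.

Lemma const_ringP T z : reflect (exists2 c, c \in T & z = const c) (z \in const_ring X T).
Proof. exact: asboolP. Qed.

Lemma polys_ringP T z :
  reflect (exists2 p : P, p \is a monalgOver T & z = tofrac p) (z \in polys_ring X T).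
Proof. exact: asboolP. Qed.

Lemma mem_const T c : (const c \in const_ring X T) = (c \in T).
Proof.
by apply/const_ringP/idP => [[d Td /const_inj ->]|Tc]; [|exists c].
Qed.

Lemma mem_polys T p : (tofrac p \in polys_ring X T) = (p \is a monalgOver T).
Proof.
apply/polys_ringP/idP => [[q Tq /eqP]|Tp]; last by exists p.
by rewrite tofrac_eq => /eqP ->.
Qed.

Lemma full_polysP z : reflect (exists p : P, z = tofrac p) (z \in polys_ring X (full_ring D)).
Proof.
apply: (iffP (polys_ringP _ _)) => [[p _ ->]|[p ->]]; first by exists p.
by exists p => //; apply/(monalgOverP (full_ring D)).
Qed.

Lemma const_mono T T' : {subset T <= T'} -> {subset const_ring X T <= const_ring X T'}.
Proof. by move=> TT' _ /const_ringP[c /TT' Tc ->]; rewrite mem_const. Qed.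

Lemma base_sub T : {subset base_ring D <= T}.
Proof. by move=> _ /asboolP[a ->]; apply: overring_tofrac. Qed.

Lemma polys_ringE T :
  ring_set (polys_ring X T) =
  mulset (ring_set (polys_ring X (base_ring D))) (ring_set (const_ring X T)).
Proof.
apply/seteqP; split=> [z|].
  move=> /polys_ringP[p Tp ->]; rewrite [p]monalgE raddf_sum /=.
  apply: big_ind => [|x y|m _]; [exact: mulset0|exact: mulsetD|].
  have -> : << p@_m *g m >> = << m >> * (p@_m)%:MP :> P.
    by rewrite [RHS](malgUM 1 (p@_m)) [1 * _]mul1r mulm1; reflexivity.
  rewrite tofracM; apply: mulset_mem; rewrite /ring_set /=.
    rewrite mem_polys; apply/(monalgOverP (base_ring D)) => k.
    by rewrite mcoeffU; case: eqP => _; rewrite ?rpred1 ?rpred0.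
  by rewrite mem_const; apply/(monalgOverP T).
apply: mulset_min => [|x y|x y].
- exact: rpred0.
- exact: rpredD.
- move=> /polys_ringP[p Dp ->] /const_ringP[c Tc ->].
  rewrite /ring_set /= /const -tofracM mem_polys; apply/(monalgOverP T) => m.
  rewrite mulrC mcoeffCM rpredM //; apply: base_sub.
  exact/(monalgOverP (base_ring D)).
Qed.

Lemma polys_const T z :
  z \in polys_ring X T -> z \in const_ring X (full_ring D) -> z \in const_ring X T.
Proof.
move=> + /const_ringP[c _ ez]; rewrite ez mem_const mem_polys.
by rewrite monalgOverC.
Qed.

Lemma kron_coef N V p (k : {cmonom X}) :
    {in enum_fset (msupp p) &, injective (kron N V)} -> k \in msupp p ->
  (mmap polyC (kronX K N V) p)`_(kron N V k) = p@_k.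
Proof.
move=> inj kp; rewrite mmapE coef_sum (big_fsetD1 k) //= coefCM coefXn eqxx mulr1.
rewrite big1_fset => [|m]; first by rewrite addr0.
rewrite in_fsetD1 => /andP[mk mp] _; rewrite coefCM coefXn.
by case: eqP => [/inj e|]; [rewrite e ?eqxx // in mk|rewrite mulr0].
Qed.

Lemma polys_unit_const p q : p * q = 1 -> exists c, p = c%:MP.
Proof.
(* Kronecker's substitution sends p to a unit of [{poly K}], a constant. Including [mone] forces a
   monomial of p with exponent 0 to be [mone]. *)
move=> pq1; have [N [V inj]] := kron_separates (mone :: enum_fset (msupp p)).
have injp : {in enum_fset (msupp p) &, injective (kron N V)}.
  by move=> m1 m2 p1 p2; apply: inj; rewrite inE ?p1 ?p2 orbT.
have /(congr1 (fun f : {poly K} => size f == 1%N)) :=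
  congr1 (mmap polyC (kronX K N V)) pq1.
rewrite rmorphM rmorph1 size_poly1 eqxx => /idP.
rewrite size_mul_eq1 => /andP[/eqP size_p _].
exists p@_mone; apply/malgP => m; rewrite mcoeffC.
have [->|m1] := eqVneq m mone; first by rewrite mulr1n.
rewrite mulr0n; apply: contraNeq m1; rewrite mcoeff_neq0 => mp.
apply/eqP/inj; rewrite ?inE ?eqxx ?mp ?orbT //.
have : (mmap polyC (kronX K N V) p)`_(kron N V m) != 0.
  by rewrite kron_coef // mcoeff_neq0.
rewrite kron1; apply: contraNeq; rewrite -lt0n => lt0.
by rewrite nth_default // size_p.
Qed.

Lemma polys_clear p : exists c : P,
  [/\ c \is a monalgOver (base_ring D), c != 0
    & tofrac c * tofrac p \in polys_ring X (base_ring D)].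
Proof.
suff [d [d0 dp]] : exists d : D, d != 0 /\
    forall m, m \in enum_fset (msupp p) -> tofrac d * p@_m \in base_ring D.
  exists (tofrac d)%:MP; split.
  - by rewrite monalgOverC overring_tofrac.
  - by rewrite -malgC0E malgC_eq tofrac_eq0.
  rewrite -tofracM mem_polys; apply/(monalgOverP (base_ring D)) => m.
  rewrite [_@__]mcoeffCM; have [mp|mp] := boolP (m \in msupp p); first exact: dp.
  by rewrite mcoeff_outdom // mulr0 rpred0.
elim: (enum_fset _) => [|m s [d [d0 ds]]]; first by exists 1; rewrite oner_neq0.
have [a [b [b0 eab]]] := fraction_rep (p@_m).
exists (b * d); split=> [|k]; first by rewrite mulf_neq0.
rewrite inE => /orP[/eqP ->|/ds dk]; rewrite tofracM.
  rewrite eab mulrAC mulrC [tofrac b * _]mulrC mulfVK ?tofrac_eq0 //.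
  by rewrite -tofracM; apply: overring_tofrac.
by rewrite -mulrA rpredM // overring_tofrac.
Qed.

Lemma ratfuns_denominator (z : L) : exists d,
  [/\ d \in polys_ring X (base_ring D), d != 0 & d * z \in polys_ring X (base_ring D)].
Proof.
have [n [m [m0 ->]]] := fraction_rep z.
have [a [Da a0 an]] := polys_clear n; have [b [Db b0 bm]] := polys_clear m.
(* For [z = n / m], the product is [(a n) b], with a clearing n and b clearing m. *)
exists (tofrac a * (tofrac b * tofrac m)); split.
- by rewrite rpredM ?mem_polys.
- by rewrite !mulf_neq0 ?tofrac_eq0.
rewrite -mulrA -mulrA [tofrac m * _]mulrC divfK ?tofrac_eq0 //.
by rewrite mulrCA rpredM ?mem_polys.
Qed.

Lemma full_polys_Pic (I : set L) : invertible_ideal (polys_ring X (full_ring D)) I ->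
  exists2 u : L, u != 0 & I = mulset [set u] (ring_set (polys_ring X (full_ring D))).
Proof.
have mem p : tofrac p \in polys_ring X (full_ring D) by apply/full_polysP; exists p.
apply: invertible_principal_of_gens => m f a _ Bf Ba /full_polysP[q ->] q0 Bfa sfa.
have [f0 fE] : exists g : 'I_m -> P, forall i, f i = tofrac (g i).
  by have [g] := choice (fun i => elimT (full_polysP _) (Bf i)); exists g.
have [a0 aE] : exists g : 'I_m -> P, forall i, a i = tofrac (g i).
  by have [g] := choice (fun i => elimT (full_polysP _) (Ba i)); exists g.
have [h hE] : exists h : 'I_m -> 'I_m -> P, forall i j, f i * a j = tofrac q * tofrac (h i j).
  have Bfai i : exists g : 'I_m -> P, forall j, f i * a j = tofrac q * tofrac (g j).
    have Bfaij j : exists p : P, f i * a j = tofrac q * tofrac p.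
      by have [_ /full_polysP[p ->] e] := Bfa i j; exists p.
    by have [g] := choice Bfaij; exists g.
  by have [h] := choice Bfai; exists h.
have inj (u v : P) : tofrac u = tofrac v -> u = v by move=> /eqP; rewrite tofrac_eq => /eqP.
have fa i j : f0 i * a0 j = q * h i j.
  by apply: inj; rewrite [LHS]tofracM [RHS]tofracM -fE -aE.
have sfa0 : \sum_i f0 i * a0 i = q.
  apply: inj; rewrite [LHS]raddf_sum -sfa.
  by apply: eq_bigr => i _; rewrite [LHS]tofracM -fE -aE.
have {}q0 : q != 0 by rewrite tofrac_eq0 in q0.
have [d [f' [c [fd da]]]] := @malg_gens X K m f0 a0 q h fa sfa0 q0.
exists (tofrac (d : P)), (fun i => tofrac (f' i : P)), (fun i => tofrac (c i : P)).
split=> [|i|i|i|i]; [exact: mem|exact: mem|exact: mem| |].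
  rewrite fE; exact: etrans (congr1 (fun u : P => tofrac u) (fd i)) (tofracM _ _).
rewrite aE -[LHS]tofracM -[RHS]tofracM.
exact: (congr1 (fun u : P => tofrac u) (da i)).
Qed.

End Concrete.

Section ConstImage.
Variables (D : idomainType) (X : choiceType).
Local Notation K := {fraction D}.
Local Notation const := (@const D X).

Lemma const_ring_image (T : overring D) : ring_set (const_ring X T) = const @` ring_set T.
Proof.
apply/seteqP; split=> [z /const_ringP[c Tc ->]|_ [c Tc <-]]; first by exists c.
by rewrite /ring_set /= mem_const.
Qed.

Lemma mulset_const (I J : set K) : mulset (const @` I) (const @` J) = const @` mulset I J.
Proof.
apply/seteqP; split.
  apply: mulset_min.
  - by exists 0; [exact: mulset0|exact: const0].
  - by move=> _ _ [x Ix <-] [y Iy <-]; exists (x + y); [exact: mulsetD|exact: constD].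
  - by move=> _ _ [x Ix <-] [y Jy <-]; exists (x * y); [exact: mulset_mem|exact: constM].
move=> _ [z IJz <-]; move: z IJz.
apply: (@mulset_min _ _ _ [set z | mulset (const @` I) (const @` J) (const z)]) => /=.
- by rewrite const0; apply: mulset0.
- by move=> x y; rewrite constD; apply: mulsetD.
- by move=> x y Ix Jy; rewrite constM; apply: mulset_mem; [exists x|exists y].
Qed.

End ConstImage.

Theorem corollary7p7 (D : idomainType)
    (D_not_field : exists x : {fraction D}, x \notin base_ring D)
    (Theta : set (overring D)) (HTheta : Jaffard_family Theta)
    (X : choiceType) :
  exists phi : {additive LPic_polys X (base_ring D) ->
                  dsum (fun T : {T : overring D | Theta T} => LPic_polys X (sval T))},
    bijective phi.
Proof.
have [flatT _ complT indepT finT] := HTheta.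
pose J : choiceType := {classic {T : overring D | Theta T}}.
pose T (j : J) : subringClosed (ratfuns D X) := const_ring X (sval j).
pose TX (j : J) : subringClosed (ratfuns D X) := polys_ring X (sval j).
have sval_inj (i j : J) : sval i = sval j -> i = j.
  by case: i j => [R hR] [S hS] /= RS; apply: eq_exist.
apply: (@LPic_dsum (ratfuns D X) (const_ring X (base_ring D)) (const_ring X (full_ring D))
  (polys_ring X (base_ring D)) (polys_ring X (full_ring D)) J T TX).
- by move=> j; apply: const_mono; apply: base_sub.
- by move=> j; apply: const_mono.
- exact: const_mono.
- by move=> j; apply: polys_ringE.
- exact: polys_ringE.
- exact: polys_const.
- by move=> _ /const_ringP[c _ ->]; rewrite constV mem_const.
- move=> _ /const_ringP[c _ ->]; have [n [d [d0 ->]]] := fraction_rep c.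
  exists (const X (tofrac d)); rewrite mem_const overring_tofrac const_eq0 tofrac_eq0.
  split=> //; rewrite -constM mulrC divfK ?tofrac_eq0 // mem_const.
  exact: overring_tofrac.
- exact: ratfuns_denominator.
- move=> u /full_polysP[p ->] /full_polysP[q pq].
  (* As [0^-1 = 0], the hypotheses admit [u = 0], which is a constant too. *)
  have [p0|p0] := eqVneq (tofrac p : ratfuns D X) 0; first by rewrite p0 rpred0.
  have [c ->] : exists c, p = c%:MP.
    apply: (@polys_unit_const _ _ p q).
    by apply/eqP; rewrite -tofrac_eq [X in X == _]tofracM -pq mulfV // tofrac1.
  by apply/const_ringP; exists c.
- exact: full_polys_Pic.
- move=> j _ /const_ringP[c Tc ->]; rewrite /T const_ring_image -const1.
  have := flat_denominators (flatT _ (svalP j)) Tc => Tc1.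
  have : (const X @` mulset [set x | x \in base_ring D /\ x * c \in base_ring D]
    (ring_set (sval j))) (const X 1) by exists 1.
  rewrite -mulset_const; apply: mulset_mono => // _ [x [Dx Dxc] <-] /=.
  split; first by rewrite mem_const.
  by rewrite -(constM X x c) mem_const.
- move=> i j _ ij /const_ringP[c _ ->]; rewrite /T !const_ring_image mulset_const.
  exists c => //; rewrite (indepT _ _ (svalP i) (svalP j)) // => eij.
  by move/eqP: ij; apply; apply: sval_inj.
- move=> _ /const_ringP[_ /asboolP[d ->] ->]; rewrite const_eq0 tofrac_eq0 => d0.
  rewrite constV; apply: sub_finite_set (finite_preimage (f := fun j : J => sval j) _ (finT d d0)).
    by move=> j /=; rewrite /T mem_const => dT; split=> //; apply: svalP.
  by move=> i j _ _; apply: sval_inj.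
(* All elements of I are constants, so I is pulled back along [const] to an ideal of D. *)
- move=> I [I0 ID IM] IA I1.
  pose I' := [set c | I (const X c)].
  have sI' : submodule (base_ring D) I'.
    split; rewrite /I' /=; first by rewrite const0.
      by move=> x y Ix Iy; rewrite constD; apply: ID.
    by move=> a x Aa Ix; rewrite constM; apply: IM; rewrite ?mem_const.
  have I'A : I' `<=` ring_set (base_ring D).
    by move=> c /IA; rewrite /ring_set /= mem_const.
  have eI : I = const X @` I'.
    apply/seteqP; split=> [z Iz|_ [c Ic <-] //].
    by have /const_ringP[c _ ez] := IA _ Iz; exists c; rewrite /I' /= -?ez.
  have : I' 1.
    rewrite (complT I' sI' I'A) => R TR.
    have := I1 (exist _ R TR); rewrite eI /T const_ring_image mulset_const -const1.
    by move=> [c Rc /const_inj <-].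
  by rewrite /I' /= const1.
(* Coefficientwise: completeness for the unit ideal says that D is the intersection of the T. *)
- move=> z /full_polysP[p ->] pT; rewrite mem_polys; apply/(monalgOverP (base_ring D)) => m.
  have sD := submodule_ring (base_ring D).
  suff : ring_set (base_ring D) p@_m by [].
  rewrite (complT _ sD) // => R TR; rewrite mulset_extend; last exact: base_sub.
  have := pT (exist _ R TR); rewrite /TX mem_polys => /(monalgOverP R); exact.
Qed.
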